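(* Let $X$ be a complete doubling metric space, let $\{E_{\mathtt{i}}\}_{\mathtt{i}\in\Sigma}$ be a Moran construction in $X$ with limit set $E$, and let $\mu$ be a measure on $E$. Suppose that \[ \liminf_{n\to\infty}-\tfrac1n\log\operatorname{diam}(E_{\mathtt{i}|_n})>0\quad\text{for each }\mathtt{i}\in\Sigma_\infty, \] and \[ \sum_{n=1}^\infty n^{-2}\sup_{\mathtt{i}\in\Sigma_n}\sum_{\mathtt{j}\prec\mathtt{i}}p_{\mathtt{j}}\bigl((\log p_{\mathtt{j}})^2+(\log c_{\mathtt{j}})^2\bigr)<\infty. \] Then for $\mu$-almost all $x_{\mathtt{i}}\in E$, \[ \overline{\dim}_{\mathrm{loc}}(\mu,x_{\mathtt{i}})=\limsup_{N\to\infty}\frac{\sum_{n=1}^N\sum_{\mathtt{j}\prec\mathtt{i}|_n}p_{\mathtt{j}}\log p_{\mathtt{j}}}{\sum_{n=1}^N\sum_{\mathtt{j}\prec\mathtt{i}|_n}p_{\mathtt{j}}\log c_{\mathtt{j}}},\qquad \underline{\dim}_{\mathrm{loc}}(\mu,x_{\mathtt{i}})=\liminf_{N\to\infty}\frac{\sum_{n=1}^N\sum_{\mathtt{j}\prec\mathtt{i}|_n}p_{\mathtt{j}}\log p_{\mathtt{j}}}{\sum_{n=1}^N\sum_{\mathtt{j}\prec\mathtt{i}|_n}p_{\mathtt{j}}\log c_{\mathtt{j}}}. \]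
   Context: A metric space is doubling if there is $N$ such that every closed ball $B(x,r)$ is covered by $N$ closed balls of radius $r/2$. A ''measure'' is a nontrivial Borel regular outer measure, finite on bounded sets. Local dimensions: $\overline{\dim}_{\mathrm{loc}}(\mu,x)=\limsup_{r\downarrow0}\log\mu(B(x,r))/\log r$, $\underline{\dim}_{\mathrm{loc}}(\mu,x)=\liminf_{r\downarrow0}\log\mu(B(x,r))/\log r$. Words: $I$ countable, $I^0=\{\varnothing\}$, $I^\infty=I^{\mathbb{N}}$; $\mathtt{i}|_n=i_1\cdots i_n$, $\mathtt{i}|_0=\varnothing$, $\mathtt{i}^-=\mathtt{i}|_{n-1}$ for $\mathtt{i}\in I^n$. For $\Sigma\subset\bigcup_{n\ge0}I^n$, $\Sigma_n=\Sigma\cap I^n$, $\Sigma_\infty=\{\mathtt{i}\in I^\infty:\mathtt{i}|_n\in\Sigma_n\ \forall n\}$; $\mathtt{j}\prec\mathtt{i}$ means $\mathtt{j}=\mathtt{i}i\in\Sigma$ for some $i\in I$. $\Sigma$ is a codetree if $\varnothing\in\Sigma$, $\mathtt{i}^-\in\Sigma$ whenever $\varnothing\neq\mathtt{i}\in\Sigma$, and every $\mathtt{i}\in\Sigma$ has a positive finite number of offspring. A Moran construction is a collection $\{E_{\mathtt{i}}\subset X:\mathtt{i}\in\Sigma\}$ of compact sets of positive diameter, $\Sigma$ a codetree, with: (M1) $E_{\mathtt{i}}\subset E_{\mathtt{i}^-}$; (M2) $\operatorname{diam}(E_{\mathtt{i}|_n})\to0$ for each $\mathtt{i}\in\Sigma_\infty$;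 (M3) $E_{\mathtt{i}i}\cap E_{\mathtt{i}j}=\emptyset$ for $i\ne j$; (M4) a uniform $C_0>0$ such that each $E_{\mathtt{i}}$ contains $B(x,C_0\operatorname{diam}(E_{\mathtt{i}}))$ for some $x\in E_{\mathtt{i}}$; (M5) $\log\operatorname{diam}(E_{\mathtt{i}|_n})/\log\min\{\operatorname{diam}(E_{\mathtt{j}}):\mathtt{j}\prec\mathtt{i}|_n\}\to1$ uniformly in $\mathtt{i}\in\Sigma_\infty$. Limit set $E=\bigcap_n\bigcup_{\mathtt{i}\in\Sigma_n}E_{\mathtt{i}}$; $x_{\mathtt{i}}$ is the point of $\bigcap_nE_{\mathtt{i}|_n}$ for $\mathtt{i}\in\Sigma_\infty$. For $\varnothing\ne\mathtt{i}\in\Sigma$: $p_{\mathtt{i}}=\mu(E_{\mathtt{i}})/\mu(E_{\mathtt{i}^-})$, $c_{\mathtt{i}}=\operatorname{diam}(E_{\mathtt{i}})/\operatorname{diam}(E_{\mathtt{i}^-})$; $p_\varnothing=\mu(E_\varnothing)$, $c_\varnothing=\operatorname{diam}(E_\varnothing)$; if $\mu(E_{\mathtt{i}})=0$ then $p_{\mathtt{j}}=0$ for all $\mathtt{j}\prec\mathtt{i}$. The convention $0\log0=0$ (and $0\cdot(\log 0)^2=0$) is used. *)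

(* Defs.v *)
From HB Require Import structures.
From mathcomp Require Import all_boot all_order all_algebra.
From mathcomp Require Import all_classical all_reals all_analysis.

Set Implicit Arguments.
Unset Strict Implicit.
Unset Printing Implicit Defensive.

Import Order.TTheory GRing.Theory Num.Theory numFieldNormedType.Exports.
Local Open Scope classical_set_scope.
Local Open Scope ring_scope.

Section MetricDefs.
Variables (R : realType) (X : Type) (d : X -> X -> R).

Definition is_metric : Prop :=
  [/\ forall x y, 0 <= d x y,
      forall x y, d x y = 0 <-> x = y,
      forall x y, d x y = d y x &
      forall x y z, d x z <= d x y + d y z].

Definition cball (x : X) (r : R) : set X := [set y | d x y <= r].

Definition oball (x : X) (r : R) : set X := [set y | d x y < r].

Definition open_d (A : set X) : Prop :=
  forall x, A x -> exists2 r, 0 < r & oball x r `<=` A.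

Definition cauchy_seq_d (u : nat -> X) : Prop :=
  forall e, 0 < e -> exists N, forall m n, (N <= m)%N -> (N <= n)%N ->
    d (u m) (u n) < e.

Definition converges_d (u : nat -> X) : Prop :=
  exists x, forall e, 0 < e -> exists N, forall n, (N <= n)%N -> d (u n) x < e.

Definition complete_d : Prop := forall u, cauchy_seq_d u -> converges_d u.

Definition doubling_d : Prop :=
  exists N : nat, forall x r, 0 < r ->
    exists y : 'I_N -> X, cball x r `<=` \bigcup_(k in setT) cball (y k) (r / 2).

Definition compact_d (K : set X) : Prop :=
  forall (J : Type) (U : J -> set X), (forall j, open_d (U j)) ->
    K `<=` \bigcup_(j in setT) U j ->
    exists2 D : set J, finite_set D & K `<=` \bigcup_(j in D) U j.

Definition bounded_d (A : set X) : Prop := exists x r, A `<=` cball x r.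

Definition diam (A : set X) : R :=
  sup [set r | exists x y, [/\ A x, A y & r = d x y]].

Definition borel_d (A : set X) : Prop := <<s open_d >> A.

Definition is_measure_d (mu : {outer_measure set X -> \bar R}) : Prop :=
  [/\ (0 < mu setT)%E,
      forall A, borel_d A -> mu.-caratheodory A,
      forall A, exists B, [/\ borel_d B, A `<=` B & mu B = mu A] &
      forall A, bounded_d A -> (mu A < +oo)%E].

(** upper and lower local dimensions (extended-real valued, log 0 = -oo) *)
Definition ldim_up (mu : set X -> \bar R) (x : X) : \bar R :=
  limf_esup (fun r : R => (lne (mu (cball x r)) * ((ln r)^-1)%:E)%E) (0:R)^'+.

Definition ldim_low (mu : set X -> \bar R) (x : X) : \bar R :=
  limf_einf (fun r : R => (lne (mu (cball x r)) * ((ln r)^-1)%:E)%E) (0:R)^'+.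

End MetricDefs.

Section Words.
Variables (I : countType).

Definition restr (i : nat -> I) (n : nat) : seq I := mkseq i n.

Definition children (Sigma : set (seq I)) (w : seq I) : set I :=
  [set a | Sigma (rcons w a)].

Definition is_codetree (Sigma : set (seq I)) : Prop :=
  [/\ Sigma [::],
      forall w a, Sigma (rcons w a) -> Sigma w &
      forall w, Sigma w ->
        finite_set (children Sigma w) /\ children Sigma w !=set0].

Definition Sigma_n (Sigma : set (seq I)) (n : nat) : set (seq I) :=
  [set w | Sigma w /\ size w = n].

Definition Sigma_inf (Sigma : set (seq I)) : set (nat -> I) :=
  [set i | forall n, Sigma (restr i n)].

End Words.

Section Moran.
Variables (R : realType) (X : Type) (d : X -> X -> R) (I : countType).
Variables (Sigma : set (seq I)) (E : seq I -> set X).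

Definition mindiam (w : seq I) : R :=
  inf [set diam d (E (rcons w a)) | a in children Sigma w].

Definition is_Moran : Prop :=
  is_codetree Sigma /\
  (forall w, Sigma w -> compact_d d (E w) /\ 0 < diam d (E w)) /\
  (forall w a, Sigma (rcons w a) -> E (rcons w a) `<=` E w) /\
  (forall i, Sigma_inf Sigma i ->
     (fun n => diam d (E (restr i n))) @ \oo --> (0 : R)) /\
  (forall w a b, Sigma (rcons w a) -> Sigma (rcons w b) -> a <> b ->
     E (rcons w a) `&` E (rcons w b) = set0) /\
  (exists2 C0 : R, 0 < C0 & forall w, Sigma w ->
     exists2 x, E w x & cball d x (C0 * diam d (E w)) `<=` E w) /\
  (forall e : R, 0 < e -> exists n0, forall i, Sigma_inf Sigma i ->
     forall n, (n0 <= n)%N ->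
     `| ln (diam d (E (restr i n))) / ln (mindiam (restr i n)) - 1 | < e).

Definition limit_set : set X :=
  \bigcap_(n in setT) \bigcup_(w in Sigma_n Sigma n) E w.

Variable mu : set X -> \bar R.

Definition pw (w : seq I) (a : I) : R :=
  let m := fine (mu (E w)) in
  if m == 0 then 0 else fine (mu (E (rcons w a))) / m.

Definition cw (w : seq I) (a : I) : R :=
  diam d (E (rcons w a)) / diam d (E w).

(** sum over offspring of w of p_j ((log p_j)^2 + (log c_j)^2);
    ln 0 = 0 in mathcomp, which realizes the convention 0 (log 0)^2 = 0 *)
Definition second_moment (w : seq I) : R :=
  \sum_(a \in children Sigma w)
     pw w a * (ln (pw w a) ^+ 2 + ln (cw w a) ^+ 2).

Definition entropy_sum (i : nat -> I) (N : nat) : R :=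
  \sum_(1 <= n < N.+1) \sum_(a \in children Sigma (restr i n))
      pw (restr i n) a * ln (pw (restr i n) a).

Definition lyapunov_sum (i : nat -> I) (N : nat) : R :=
  \sum_(1 <= n < N.+1) \sum_(a \in children Sigma (restr i n))
      pw (restr i n) a * ln (cw (restr i n) a).

Definition dim_ratio (i : nat -> I) (N : nat) : R :=
  entropy_sum i N / lyapunov_sum i N.

End Moran.

(* Main.v *)
(* The offspring sums are conditional expectations: along a mu-random path the
   differences between log p (resp. log c) of the chosen child and its conditional
   mean are martingale differences, whose second moments are summable against
   1/n^2.  A Hajek-Renyi argument on the tree makes their averages vanish almost
   everywhere, and since -log diam grows linearly the symbolic quotients
   log mu(E_n) / log diam(E_n) have the same upper and lower limits as the quotients
   of the averaged sums.

   It remains to replace cylinders by balls.  One inequality is E_n in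
   B(x, diam E_n).  For the other, cylinders of one generation and comparable
   diameter contain disjoint comparable balls by (M4), so by doubling the balls
   B(x, diam^(1-1/h)) attached to them overlap at most diam^(-s/h) times up to a
   constant; hence the cylinders carrying much less mass than their ball have
   small total mass, and Borel-Cantelli applies because only the generations
   n <= L log(1/diam) matter.  By (M5) every small radius r lies between diam E_n
   and (diam E_n)^(1-1/h) for some n. *)

Require Import Defs.
From HB Require Import structures.
From mathcomp Require Import all_boot all_order all_algebra.
From mathcomp Require Import all_classical all_reals all_analysis.
From mathcomp Require Import ring lra zify.
Import Order.TTheory GRing.Theory Num.Theory numFieldNormedType.Exports.
Local Open Scope classical_set_scope.
Local Open Scope ring_scope.
Set Implicit Arguments.
Unset Strict Implicit.
Unset Printing Implicit Defensive.

(** * Comparison of upper and lower limits *)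

Section Limits.
Variable R : realType.

(** Since [|b| <= |a| + |b - a|] and [e <= 1 / 2], the part [e * |b - a|] of the error can be
    absorbed on the left. *)
Lemma close_sym (a b e : R) : 0 < e <= 1 / 2 ->
  `|a - b| <= e * (1 + `|b|) -> `|b - a| <= 2 * e * (1 + `|a|).
Proof.
move=> /andP[e0 e1]; rewrite distrC => h.
have hb : `|b| <= `|a| + `|b - a| by rewrite -{1}[b](subrK a) addrC ler_normD.
have h2 : e * `|b| <= e * (`|a| + `|b - a|) by rewrite ler_pM2l.
have h3 : e * `|b - a| <= 1 / 2 * `|b - a| by rewrite ler_wpM2r.
lra.
Qed.

(** The error is relative because the quotients may be unbounded. For [b] far below the supremum [z]
    the error [e * |b|] can be large, but when [e <= 1] the gap [z - b] absorbs it. *)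
Lemma limf_esup_le_close (T1 T2 : choiceType) (X1 : filteredType T1)
    (X2 : filteredType T2) (f : X1 -> \bar R) (g : X2 -> \bar R)
    (F : set (set X1)) (G : set (set X2)) :
  (forall e : R, 0 < e -> forall V, G V -> exists2 U, F U &
     forall x, U x -> exists y a b, [/\ V y, f x = a%:E, g y = b%:E &
       `|a - b| <= e * (1 + `|b|)]) ->
  (limf_esup f F <= limf_esup g G)%E.
Proof.
move=> h; apply: le_ereal_inf_tmp => _ [V GV <-].
have ub y b : V y -> g y = b%:E -> (b%:E <= ereal_sup (g @` V))%E.
  by move=> Vy gy; apply: ereal_sup_ubound; exists y.
case: (ereal_sup (g @` V)) ub => [z| |] ub; last 2 first.
- by rewrite leey.
(* A supremum [-oo] leaves no real value for [g] on [V], so [U] must be empty. *)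
- have [U FU hU] := h _ ltr01 _ GV.
  apply: (@le_trans _ _ (ereal_sup (f @` U))).
    by apply: ereal_inf_lbound; exists U.
  apply: ge_ereal_sup => _ [x Ux <-].
  by have [y [a [b [Vy _ gy _]]]] := hU _ Ux; have := ub _ _ Vy gy.
apply/lee_addgt0Pr => e e0.
pose e' := Num.min 1 (e / (1 + `|z|)).
have z0 : 0 < 1 + `|z| by rewrite ltr_pwDl.
have e'0 : 0 < e' by rewrite lt_min ltr01 divr_gt0.
have e'1 : e' <= 1 by rewrite ge_min lexx.
have e'e : e' * (1 + `|z|) <= e.
  by rewrite -ler_pdivlMr// /e' ge_min lexx orbT.
have [U FU hU] := h _ e'0 _ GV.
apply: (@le_trans _ _ (ereal_sup (f @` U))).
  by apply: ereal_inf_lbound; exists U.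
apply: ge_ereal_sup => _ [x Ux <-].
have [y [a [b [Vy -> gy ab]]]] := hU _ Ux.
have := ub _ _ Vy gy; rewrite -EFinD !lee_fin => bz.
have h1 : `|b| <= `|z| + (z - b).
  rewrite -[X in _ + X]ger0_norm ?subr_ge0// -[X in `|X| <= _](subKr z).
  exact: ler_normB.
have h2 : e' * `|b| <= e' * (`|z| + (z - b)) by rewrite ler_pM2l.
have h3 : e' * (z - b) <= 1 * (z - b) by rewrite ler_wpM2r// subr_ge0.
have h4 : a - b <= `|a - b| by rewrite ler_norm.
lra.
Qed.

Lemma limf_close (T1 T2 : choiceType) (X1 : filteredType T1)
    (X2 : filteredType T2) (f : X1 -> \bar R) (g : X2 -> \bar R)
    (F : set (set X1)) (G : set (set X2)) :
  (forall e : R, 0 < e -> forall V, G V -> exists2 U, F U &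
     forall x, U x -> exists y a b, [/\ V y, f x = a%:E, g y = b%:E &
       `|a - b| <= e * (1 + `|b|)]) ->
  (forall e : R, 0 < e -> forall U, F U -> exists2 V, G V &
     forall y, V y -> exists x a b, [/\ U x, f x = a%:E, g y = b%:E &
       `|a - b| <= e * (1 + `|b|)]) ->
  limf_esup f F = limf_esup g G /\ limf_einf f F = limf_einf g G.
Proof.
move=> h1 h2.
have h2' (e : R) : 0 < e -> forall U, F U -> exists2 V, G V &
     forall y, V y -> exists x b a, [/\ U x, g y = b%:E, f x = a%:E &
       `|b - a| <= e * (1 + `|a|)].
  move=> e0 U FU; pose e' := Num.min (1 / 2) (e / 2).
  have e'0 : 0 < e' by rewrite lt_min !divr_gt0.
  have e'1 : e' <= 1 / 2 by rewrite ge_min lexx.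
  have e'e : e' <= e / 2 by rewrite ge_min lexx orbT.
  have [V GV hV] := h2 _ e'0 _ FU; exists V => // y Vy.
  have [x [a [b [Ux fx gy ab]]]] := hV _ Vy.
  exists x, b, a; split => //.
  apply: (le_trans (close_sym _ ab)); first by rewrite e'0.
  rewrite ler_wpM2r// ?addr_ge0//; lra.
split.
  by apply/eqP; rewrite eq_le; apply/andP; split; exact: limf_esup_le_close.
rewrite /limf_einf; congr (- _)%E.
have N (a b : R) : `|- a - - b| = `|a - b| by rewrite -opprD normrN.
apply/eqP; rewrite eq_le; apply/andP; split; apply: limf_esup_le_close.
- move=> e e0 V GV; have [U FU hU] := h1 _ e0 _ GV; exists U => // x Ux.
  have [y [a [b [Vy fx gy ab]]]] := hU _ Ux.
  by exists y, (- a), (- b); rewrite fx gy N normrN.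
- move=> e e0 U FU; have [V GV hV] := h2' _ e0 _ FU; exists V => // y Vy.
  have [x [a [b [Ux gy fx ab]]]] := hV _ Vy.
  by exists x, (- a), (- b); rewrite fx gy N normrN.
Qed.

(** The difference splits into [(a - A) / b] and [A / B * ((B - b) / b)]. Both numerators are
    controlled by [l * n], while [|b| >= c * n]. *)
Lemma ratio_close (a A b B c l n : R) : 0 < n -> 0 < c -> 0 <= l ->
  `|a - A| <= l * n -> `|b - B| <= l * n -> b <= - (c * n) -> B != 0 ->
  `|a / b - A / B| <= l / c * (1 + `|A / B|).
Proof.
move=> n0 c0 l0 aA bB bc B0.
have cn : 0 < c * n by rewrite mulr_gt0.
have b0 : b < 0 by lra.
have -> : a / b - A / B = (a - A) / b + A / B * ((B - b) / b).
  by field; rewrite B0 lt_eqF.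
have bn : c * n <= `|b| by rewrite ltr0_norm//; lra.
have hq (u : R) : `|u| <= l * n -> `|u / b| <= l / c.
  move=> un; rewrite normrM normfV ler_pdivrMr ?normr_gt0 ?lt_eqF//.
  apply: (le_trans un); rewrite mulrAC ler_pdivlMr//.
  by rewrite -mulrA ler_wpM2l// mulrC.
apply: (le_trans (ler_normD _ _)); rewrite mulrDr mulr1 lerD//; first exact: hq.
by rewrite normrM mulrC ler_wpM2r// hq// distrC.
Qed.

(** Kronecker's lemma in the form of the Hajek-Renyi bound. Beyond [K1] the series has tail at most
    [e / 2]; a larger [K] makes the terms before [K1], divided by [K ^ 2], at most [e / 2]. The
    terms between [K1] and [K] only grow when divided by [k ^ 2], and so join the tail. *)
Lemma kronecker_tail (v : nat -> R) (C : R) : (forall k, 0 <= v k) ->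
  (forall N, \sum_(1 <= k < N) v k / k%:R ^+ 2 <= C) ->
  forall e, 0 < e -> exists2 K, (0 < K)%N & forall J,
    (\sum_(1 <= k < K) v k) / K%:R ^+ 2
      + \sum_(K <= k < K + J) v k / k%:R ^+ 2 <= e.
Proof.
move=> v0 bd e e0.
have t0 k : 0 <= v k / k%:R ^+ 2 by rewrite divr_ge0// exprn_ge0.
pose A := [set \sum_(1 <= k < N) v k / k%:R ^+ 2 | N in [set: nat]].
have hsA : has_sup A.
  split; first by exists (\sum_(1 <= k < 0) v k / k%:R ^+ 2), 0%N.
  by exists C => _ [N _ <-].
have [_ [K0 _ <-] hK] := sup_adherent (divr_gt0 e0 (ltr0n _ 2)) hsA.
pose K1 := maxn K0 1.
have tail L : (K1 <= L)%N ->
    \sum_(K1 <= k < L) v k / k%:R ^+ 2 <= e / 2.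
  move=> K1L.
  have : \sum_(1 <= k < L) v k / k%:R ^+ 2 <= sup A.
    by apply: ub_le_sup; [case: hsA | exists L].
  rewrite (big_cat_nat _ K1L) ?leq_maxr//=.
  have : \sum_(1 <= k < K0) v k / k%:R ^+ 2
      <= \sum_(1 <= k < K1) v k / k%:R ^+ 2.
    case: (leqP 1 K0) => [K01|K00].
      by rewrite /K1 (maxn_idPl K01).
    by rewrite !big_geq// /K1; lia.
  move: hK; rewrite ltrBlDr; lra.
pose W := \sum_(1 <= k < K1) v k.
have W0 : 0 <= W by apply: sumr_ge0.
pose K := maxn K1 (Num.truncn (2 * W / e)).+1.
have K0' : (0 < K)%N by rewrite /K; lia.
exists K => // J.
have K1K : (K1 <= K)%N by rewrite leq_maxl.
have KK : 0 < K%:R ^+ 2 :> R by rewrite exprn_gt0// ltr0n.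
rewrite (big_cat_nat _ K1K) ?leq_maxr//= mulrDl.
have h1 : W / K%:R ^+ 2 <= e / 2.
  rewrite ler_pdivrMr//.
  have : 2 * W / e < K%:R.
    apply: (lt_le_trans (truncnS_gt _)); rewrite ler_nat leq_maxr//.
  rewrite ltr_pdivrMr// => h.
  have : K%:R * e <= K%:R ^+ 2 * e.
    by rewrite ler_pM2r// expr2 ler_peMl// ler1n.
  lra.
have h2 : (\sum_(K1 <= k < K) v k) / K%:R ^+ 2
    <= \sum_(K1 <= k < K) v k / k%:R ^+ 2.
  rewrite mulr_suml; apply: ler_sum_nat => k /andP[k1 kK].
  rewrite ler_wpM2l// lef_pV2 ?posrE ?exprn_gt0 ?ltr0n//.
  - by rewrite lerXn2r ?nnegrE// ler_nat ltnW.
  - by move: k1; rewrite /K1; lia.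
have := tail (K + J)%N (leq_trans K1K (leq_addr _ _)).
rewrite (big_cat_nat K1K (leq_addr _ _))/=.
rewrite -/W; lra.
Qed.

End Limits.

(** * Limits over radii, over generations and of averaged sums *)

Section LocalDimensionLimits.
Variable R : realType.

Lemma at_right0P (U : set R) :
  (0 : R)^'+ U <-> exists2 e, 0 < e & forall r, 0 < r < e -> U r.
Proof.
split=> [/nbhs_ballP [e e0 he]|[e e0 he]].
  exists e => // r /andP[r0 re]; apply: he => //.
  by rewrite /ball/= sub0r normrN gtr0_norm.
near=> r; apply: he; apply/andP; split; near: r.
  exact: nbhs_right_gt.
exact: nbhs_right_lt.
Unshelve. all: by end_near. Qed.

Lemma nbhs_ooP (V : set nat) :
  \oo V <-> exists N, forall n, (N <= n)%N -> V n.
Proof. by split=> [[N _ hN]|[N hN]]; exists N. Qed.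

(** Applied with [L = - ln (D n)], [l = - ln r], [a = ln (m n)] and [b = ln (beta r)]: numerator and
    denominator both move by a small multiple of [L]. *)
Lemma log_ratio_close (L l a b e K : R) : 0 < L -> 0 < e <= 1 / 2 -> 0 <= K ->
  (1 - e) * L <= l -> l <= L -> a <= b -> b <= a + K * e * L ->
  `|b / - l - a / - L| <= 2 * e * (1 + K) * (1 + `|a / - L|).
Proof.
move=> L0 /andP[e0 e1] K0 lL1 lL2 ab ba.
have l2 : L <= 2 * l.
  have : (1 - e) * L >= 1 / 2 * L by rewrite ler_pM2r//; lra.
  lra.
have l0 : 0 < l by lra.
set q := a / - L; have aE : a = - q * L by rewrite /q; field; rewrite gt_eqF.
have -> : b / - l - q = ((a - b) + q * (L - l)) / l.
  by rewrite aE; field; rewrite gt_eqF.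
rewrite normrM normfV (gtr0_norm l0) ler_pdivrMr//.
apply: (le_trans (ler_normD _ _)).
have h1 : `|a - b| <= K * e * L by rewrite ler_norml; lra.
have h2 : `|q * (L - l)| <= `|q| * (e * L).
  rewrite normrM ler_wpM2l// ger0_norm ?subr_ge0//; lra.
have h3 : e * (K + `|q|) * L <= e * (K + `|q|) * (2 * l).
  by rewrite ler_wpM2l// mulr_ge0 ?addr_ge0// ltW.
have h4 : e * l * (K + `|q|) <= e * l * ((1 + K) * (1 + `|q|)).
  rewrite ler_wpM2l ?mulr_ge0 ?ltW//.
  have : 0 <= K * `|q| by rewrite mulr_ge0.
  lra.
lra.
Qed.

(** A radius [r] is matched with the first [n] such that [D n <= r]. Then [r <= D n.-1], and the
    slow decay of [D] gives [ln r <= (1 - 1/h) ln (D n)], so both mass bounds apply. Conversely a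
    generation [n] is matched with the radius [D n]. *)
Lemma ball_symbolic_limits (D m : nat -> R) (beta : R -> R) (F : R -> \bar R)
    (K : R) : 0 <= K ->
  (forall n, 0 < D n) -> (forall n k, (n <= k)%N -> D k <= D n) ->
  D @ \oo --> (0 : R) -> (forall n, 0 < m n) ->
  (forall n r, D n <= r -> m n <= beta r) ->
  (forall r, 0 < r -> 0 < beta r -> F r = (ln (beta r) / ln r)%:E) ->
  (forall h, (0 < h)%N -> exists n0, forall n, (n0 <= n)%N -> forall r,
     0 < r -> 0 < beta r -> ln r <= (1 - h%:R^-1) * ln (D n) ->
     ln (beta r) <= ln (m n) + K * h%:R^-1 * - ln (D n)) ->
  (forall e, 0 < e < 1 -> exists n0, forall n, (n0 <= n)%N ->
     ln (D n) <= (1 - e) * ln (D n.+1)) ->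
  limf_esup F (0 : R)^'+ = limn_esup (fun n => (ln (m n) / ln (D n))%:E) /\
  limf_einf F (0 : R)^'+ = limn_einf (fun n => (ln (m n) / ln (D n))%:E).
Proof.
move=> K0 D0 Ddec Dlim m0 mbeta FE upper grow.
have Dsmall e : 0 < e -> exists n0, forall n, (n0 <= n)%N -> D n < e.
  move=> e0; have /cvgrPdist_lt/(_ _ e0) [n _ hn] := Dlim.
  by exists n => k /hn /=; rewrite sub0r normrN gtr0_norm.
have lnle (a b : R) : 0 < a -> a <= b -> ln a <= ln b.
  by move=> a0 ab; rewrite ler_ln// posrE// (lt_le_trans a0).
have lnlt0 (a : R) : 0 < a -> a < 1 -> ln a < 0 by move=> a0 a1; rewrite ln_lt0 ?a0.
have core e : 0 < e -> exists h n0, (1 < h)%N /\ forall n, (n0 <= n)%N ->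
    [/\ D n < 1, ln (D n) <= (1 - h%:R^-1) * ln (D n.+1) &
    forall r, D n <= r -> ln r <= (1 - h%:R^-1) * ln (D n) ->
    F r = (ln (beta r) / ln r)%:E /\
    `|ln (beta r) / ln r - ln (m n) / ln (D n)|
      <= e * (1 + `|ln (m n) / ln (D n)|)].
  (* The quotient makes [2 (1 + K) / h <= e]; the second successor ensures [h >= 2], hence
     [1 / h <= 1 / 2]. *)
  move=> e0; pose h := (Num.truncn (2 * (1 + K) / e)).+2.
  have h1 : (1 < h)%N by [].
  have hp : 0 < h%:R :> R by rewrite ltr0n.
  have hi : 0 < h%:R^-1 :> R by rewrite invr_gt0.
  have hi2 : h%:R^-1 <= 1 / 2 :> R.
    by rewrite div1r lef_pV2 ?posrE// ler_nat.
  have he : 2 * h%:R^-1 * (1 + K) <= e.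
    rewrite mulrAC ler_pdivrMr// -ler_pdivrMl// mulrC.
    apply: (le_trans (ltW (truncnS_gt _))); by rewrite ler_nat.
  have [n1 up] := upper h isT.
  have [n2 gr] := grow h%:R^-1 ltac:(rewrite hi /=; lra).
  have [n3 sm] := Dsmall 1 ltr01.
  exists h, (maxn n1 (maxn n2 n3)); split => // n.
  rewrite !geq_max => /and3P[nn1 nn2 nn3]; split => [||r Dr lr].
  - exact: sm.
  - exact: gr.
  have r0 : 0 < r := lt_le_trans (D0 n) Dr.
  have b0 : 0 < beta r := lt_le_trans (m0 n) (mbeta _ _ Dr).
  split; first exact: FE.
  have L0 := lnlt0 _ (D0 n) (sm n nn3).
  rewrite -[X in _ / X - _]opprK -[X in _ - _ / X]opprK -[X in 1 + `|_ / X|]opprK.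
  apply: (@le_trans _ _ (2 * h%:R^-1 * (1 + K) * (1 + `|ln (m n) / - - ln (D n)|))).
    apply: log_ratio_close => //.
    - by rewrite oppr_gt0.
    - by rewrite hi.
    - by rewrite mulrN lerN2.
    - by rewrite lerN2 lnle.
    - by rewrite lnle// mbeta.
    - exact: up.
  by rewrite ler_wpM2r// addr_ge0.
apply: limf_close.
- move=> e e0 V /nbhs_ooP [N hN].
  have [h [n0 [h1 cr]]] := core e e0.
  pose n1 := maxn N n0.
  exists [set r | 0 < r < D n1]; first by apply/at_right0P; exists (D n1).
  move=> r /= /andP[r0 rD].
  have ex : exists n, D n <= r.
    by have [n hn] := Dsmall r r0; exists n; rewrite ltW// hn.
  case: (ex_minnP ex) => n nr nmin.
  have nn1 : (n1 < n)%N.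
    rewrite ltnNge; apply/negP => /Ddec; rewrite leNgt => /negP; apply.
    exact: le_lt_trans nr rD.
  have np : (n0 <= n.-1)%N by rewrite /n1 in nn1; lia.
  have [_ gr _] := cr _ np; have np' : (n0 <= n)%N by lia.
  have [_ _ cl] := cr _ np'.
  have rD' : r <= D n.-1.
    rewrite leNgt; apply/negP => /ltW /nmin; lia.
  have nE : n.-1.+1 = n by lia.
  have [|Fr cl'] := cl r nr.
    by apply: (le_trans (lnle _ _ r0 rD')); move: gr; rewrite nE.
  exists n, (ln (beta r) / ln r), (ln (m n) / ln (D n)); split => //.
  apply: hN; rewrite /n1 in nn1; lia.
- move=> e e0 U /at_right0P [dl dl0 hU].
  have [h [n0 [h1 cr]]] := core e e0.
  have [n1 sm] := Dsmall dl dl0.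
  exists [set n | (maxn n0 n1 <= n)%N]; first by apply/nbhs_ooP; exists (maxn n0 n1).
  move=> n /=; rewrite geq_max => /andP[/cr [D1 _ cl] /sm Dd].
  have [|Fr cl'] := cl (D n) (lexx _).
    have := lnlt0 _ (D0 n) D1 => L0.
    have : 0 <= - ln (D n) * h%:R^-1 by rewrite mulr_ge0 ?invr_ge0// oppr_ge0 ltW.
    lra.
  exists (D n), (ln (beta (D n)) / ln (D n)), (ln (m n) / ln (D n)); split => //.
  by apply: hU; rewrite D0.
Qed.

(** The shift to [n.+1] occurs because the [n]-th averaged sum takes means over children, the last
    of which lie in generation [n.+1]. *)
Lemma symbolic_average_limits (D m : nat -> R) (A B : nat -> R) (c : R) : 0 < c ->
  (exists n0, forall n, (n0 <= n)%N -> c * n%:R <= - ln (D n)) ->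
  (forall l, 0 < l -> exists n0, forall n, (n0 <= n)%N ->
     `|ln (m n.+1) - A n| <= l * n.+1%:R) ->
  (forall l, 0 < l -> exists n0, forall n, (n0 <= n)%N ->
     `|ln (D n.+1) - B n| <= l * n.+1%:R) ->
  limn_esup (fun n => (ln (m n) / ln (D n))%:E) = limn_esup (fun n => (A n / B n)%:E) /\
  limn_einf (fun n => (ln (m n) / ln (D n))%:E) = limn_einf (fun n => (A n / B n)%:E).
Proof.
move=> c0 [n1 hc] hA hB.
have core e : 0 < e -> exists n0, forall n, (n0 <= n)%N ->
    `|ln (m n.+1) / ln (D n.+1) - A n / B n| <= e * (1 + `|A n / B n|).
  (* The bound [c * e] gives the precision; [c / 2] keeps [B n] away from zero, as
     [ln (D n.+1) <= - c * n.+1]. *)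
  move=> e0; pose l := Num.min (c * e) (c / 2).
  have l0 : 0 < l by rewrite lt_min mulr_gt0//= divr_gt0.
  have lc : l <= c / 2 by rewrite ge_min lexx orbT.
  have le : l / c <= e by rewrite ler_pdivrMr// [e * c]mulrC ge_min lexx.
  have [n2 h2] := hA l l0; have [n3 h3] := hB l l0.
  exists (maxn n1 (maxn n2 n3)) => n.
  rewrite !geq_max => /and3P[nn1 /h2 hm /h3 hD].
  have b := hc n.+1 (leqW nn1).
  have np : 0 < n.+1%:R :> R by rewrite ltr0n.
  have lcn : l * n.+1%:R <= c / 2 * n.+1%:R by rewrite ler_pM2r.
  have cn : 0 < c * n.+1%:R by rewrite mulr_gt0.
  apply: (@le_trans _ _ (l / c * (1 + `|A n / B n|))).
    apply: (ratio_close np c0 (ltW l0) hm hD); first lra.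
    by apply/eqP => B0; move: hD; rewrite B0 subr0 ler_norml; lra.
  by rewrite ler_wpM2r// addr_ge0.
rewrite /limn_einf; apply: limf_close.
- move=> e e0 V /nbhs_ooP [N hN]; have [n0 h0] := core e e0.
  exists [set n | (maxn N n0 < n)%N]; first by apply/nbhs_ooP; exists (maxn N n0).+1.
  case=> // n /=; rewrite ltnS geq_max => /andP[Nn nn].
  by do 3 eexists; split; [exact: hN Nn|reflexivity|reflexivity|exact: h0].
- move=> e e0 U /nbhs_ooP [N hN]; have [n0 h0] := core e e0.
  exists [set n | (maxn N n0 <= n)%N]; first by apply/nbhs_ooP; exists (maxn N n0).
  move=> n /=; rewrite geq_max => /andP[Nn nn].
  by exists n.+1; do 2 eexists; split;
    [apply: hN; exact: leqW|reflexivity|reflexivity|exact: h0].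
Qed.

End LocalDimensionLimits.

(** * The strong law of large numbers on a weighted tree *)

Section TreeLevels.
Variables (I : eqType) (ch : seq I -> seq I).

Definition offspring (l : seq (seq I)) : seq (seq I) :=
  [seq rcons w a | w <- l, a <- ch w].

Definition level (n : nat) : seq (seq I) := iter n offspring [:: [::]].

Lemma mem_offspring l w a :
  (rcons w a \in offspring l) = (w \in l) && (a \in ch w).
Proof.
apply/allpairsPdep/andP => [[x [b [xl bx /eqP]]]|[wl aw]].
  by rewrite eqseq_rcons => /andP[/eqP-> /eqP->].
by exists w, a.
Qed.

Lemma level_rcons n w a :
  (rcons w a \in level n.+1) = (w \in level n) && (a \in ch w).
Proof. exact: mem_offspring. Qed.

Lemma size_level n w : w \in level n -> size w = n.
Proof.
elim: n w => [|n ih] w; first by rewrite inE => /eqP->.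
case: (lastP w) => [|u a].
  by move/allpairsPdep => [x [b [_ _ /eqP]]]; rewrite eq_sym -size_eq0 size_rcons.
by rewrite level_rcons size_rcons => /andP[/ih->].
Qed.

Lemma uniq_level : (forall w, uniq (ch w)) -> forall n, uniq (level n).
Proof.
move=> uch; elim=> // n ih; apply: allpairs_uniq_dep => //.
by move=> [x a] [y b] _ _ /= /eqP; rewrite eqseq_rcons => /andP[/eqP-> /eqP->].
Qed.

Lemma take_level n k w : w \in level n -> (k <= n)%N -> take k w \in level k.
Proof.
elim: n k w => [|n ih] k w.
  by rewrite leqn0 inE => /eqP-> /eqP->.
case: (lastP w) => [/size_level//|u a].
move=> /[dup] /size_level; rewrite size_rcons => -[su].
move=> /[dup] h; rewrite level_rcons => /andP[ul _].
rewrite leq_eqVlt => /orP[/eqP->|]; first by rewrite take_oversize// size_rcons su.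
by rewrite ltnS => kn; rewrite -cats1 takel_cat ?su//; exact: ih.
Qed.

End TreeLevels.

Section TreeLLN.
Variables (R : realType) (I : eqType) (ch : seq I -> seq I) (m : seq I -> R).
Hypothesis m_ge0 : forall w, 0 <= m w.
Hypothesis mE : forall n w, w \in level ch n ->
  m w = \sum_(a <- ch w) m (rcons w a).
Variable Z : seq I -> R.

(** The conditional expectation of [Z] one generation below [w], when a path is drawn according to
    [m]. *)
Definition tree_mean (w : seq I) : R :=
  \sum_(a <- ch w) m (rcons w a) / m w * Z (rcons w a).

Definition tree_msq (w : seq I) : R :=
  \sum_(a <- ch w) m (rcons w a) / m w * Z (rcons w a) ^+ 2.

(** The martingale of centred increments. It starts with the step from generation 1 to 2, to match
    the sums over [n >= 1] in the theorem. *)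
Definition tree_dev (w : seq I) : R :=
  \sum_(1 <= k < size w) (Z (take k.+1 w) - tree_mean (take k w)).

Lemma tree_dev_rcons w a : (0 < size w)%N ->
  tree_dev (rcons w a) = tree_dev w + (Z (rcons w a) - tree_mean w).
Proof.
move=> w0; rewrite /tree_dev size_rcons big_nat_recr//=; congr (_ + _).
  apply: eq_big_nat => k /andP[_ kw].
  by rewrite -cats1 !takel_cat// ltnW.
by rewrite take_oversize ?size_rcons// -cats1 take_size_cat.
Qed.

Lemma child_mass n w a : w \in level ch n -> a \in ch w -> m w = 0 ->
  m (rcons w a) = 0.
Proof.
move=> wl aw w0; have := mE wl; rewrite w0 => /esym/eqP.
by rewrite psumr_eq0// => /allP/(_ _ aw)/eqP.
Qed.

(** Undoes the normalisation by [m w]; if [m w = 0], all children have mass zero and both sides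
    vanish. *)
Lemma child_sum n w (F : I -> R) : w \in level ch n ->
  \sum_(a <- ch w) m (rcons w a) * F a =
  m w * \sum_(a <- ch w) m (rcons w a) / m w * F a.
Proof.
move=> wl; rewrite mulr_sumr big_seq [RHS]big_seq; apply: eq_bigr => a aw.
have [w0|w0] := eqVneq (m w) 0; first by rewrite (child_mass wl aw w0) w0 !mul0r.
by field.
Qed.

(* The deviations form a martingale: the cross term averages to zero. *)
Lemma tree_dev_step n w : w \in level ch n.+1 ->
  \sum_(a <- ch w) m (rcons w a) * tree_dev (rcons w a) ^+ 2
    <= m w * tree_dev w ^+ 2 + m w * tree_msq w.
Proof.
move=> wl; have sw : (0 < size w)%N by rewrite (size_level wl).
set S := tree_dev w; set H := tree_mean w.
have -> : \sum_(a <- ch w) m (rcons w a) * tree_dev (rcons w a) ^+ 2 =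
  \sum_(a <- ch w) (m (rcons w a) * (S - H) ^+ 2
     + (2 * (S - H) * (m (rcons w a) * Z (rcons w a))
     + m (rcons w a) * Z (rcons w a) ^+ 2)).
  by apply: eq_bigr => a _; rewrite tree_dev_rcons// -/S -/H; ring.
rewrite !big_split/= -mulr_suml -mulr_sumr -(mE wl) !(child_sum _ wl).
rewrite -/(tree_mean w) -/H -/(tree_msq w).
(* Once the terms in [S * H] cancel, the two sides differ exactly by this quantity. *)
have : 0 <= m w * H ^+ 2 by rewrite mulr_ge0// sqr_ge0.
nra.
Qed.

Lemma sum_offspring (l : seq (seq I)) (F : seq I -> R) :
  \sum_(u <- offspring ch l) F u = \sum_(w <- l) \sum_(a <- ch w) F (rcons w a).
Proof. exact: big_allpairs_dep. Qed.

Lemma level_mass n : \sum_(w <- level ch n) m w = m [::].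
Proof.
elim: n => [|n ih]; first by rewrite big_seq1.
rewrite -ih [LHS]sum_offspring big_seq [RHS]big_seq.
by apply: eq_bigr => w /mE.
Qed.

Variable v : nat -> R.
Hypothesis v_ge0 : forall k, 0 <= v k.
Hypothesis msq_le : forall n w, (0 < n)%N -> w \in level ch n -> tree_msq w <= v n.

(** Stated for part of a generation so that it also applies to the live words, from which the hits
    have been removed. *)
Lemma sublevel_dev_step n (l : seq (seq I)) : (0 < n)%N ->
  {subset l <= level ch n} -> \sum_(w <- l) m w <= m [::] ->
  \sum_(u <- offspring ch l) m u * tree_dev u ^+ 2
    <= \sum_(w <- l) m w * tree_dev w ^+ 2 + m [::] * v n.
Proof.
case: n => // n _ sub lm; rewrite sum_offspring.
apply: (@le_trans _ _ (\sum_(w <- l) (m w * tree_dev w ^+ 2 + m w * v n.+1))).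
  rewrite big_seq [leRHS]big_seq; apply: ler_sum => w wl.
  apply: (le_trans (tree_dev_step (sub _ wl))).
  by rewrite lerD2l ler_wpM2l// msq_le// sub.
rewrite big_split/= lerD2l -mulr_suml.
exact: ler_wpM2r.
Qed.

Lemma level_dev n : \sum_(w <- level ch n) m w * tree_dev w ^+ 2
  <= m [::] * \sum_(1 <= k < n) v k.
Proof.
(* In generations 0 and 1 the deviation is an empty sum. *)
have le1 k : (k <= 1)%N ->
    \sum_(w <- level ch k) m w * tree_dev w ^+ 2 = 0.
  move=> k1; rewrite big_seq big1// => w /size_level wk.
  by rewrite /tree_dev big_geq ?wk// expr0n mulr0.
case: n => [|n]; first by rewrite le1// mulr_ge0// sumr_ge0.
elim: n => [|n ih]; first by rewrite le1// mulr_ge0// sumr_ge0.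
apply: (le_trans (@sublevel_dev_step n.+1 (level ch n.+1) _ _ _)) => //.
  by rewrite level_mass.
by rewrite [in leRHS]big_nat_recr//= mulrDr lerD2r.
Qed.

Variable lam : R.

Definition dev_hit (w : seq I) : bool := lam * (size w)%:R < `|tree_dev w|.

(* Generation [K + j], split according to whether the first hit at or after
   generation [K] is still to come ([live]) or occurs just now ([fresh]). *)
Fixpoint live (K j : nat) : seq (seq I) :=
  if j is i.+1 then [seq u <- offspring ch (live K i) | ~~ dev_hit u]
  else [seq u <- level ch K | ~~ dev_hit u].

Definition fresh (K j : nat) : seq (seq I) :=
  if j is i.+1 then [seq u <- offspring ch (live K i) | dev_hit u]
  else [seq u <- level ch K | dev_hit u].

Lemma sub_offspring n l : {subset l <= level ch n} ->
  {subset offspring ch l <= level ch n.+1}.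
Proof.
move=> sub w; case: (lastP w) => [|u a].
  by move/allpairsPdep => [x [b [_ _ /eqP]]]; rewrite eq_sym -size_eq0 size_rcons.
by rewrite mem_offspring level_rcons => /andP[/sub-> ->].
Qed.

Lemma live_level K j : {subset live K j <= level ch (K + j)}.
Proof.
elim: j => [|j ih] w; first by rewrite addn0 mem_filter => /andP[].
by rewrite mem_filter addnS => /andP[_]; exact: sub_offspring.
Qed.

Lemma fresh_level K j : {subset fresh K j <= level ch (K + j)}.
Proof.
case: j => [|j] w; first by rewrite addn0 mem_filter => /andP[].
rewrite mem_filter addnS => /andP[_]; apply: sub_offspring.
exact: live_level.
Qed.

Lemma split_hit (l : seq (seq I)) (F : seq I -> R) :
  \sum_(u <- l) F u = \sum_(u <- [seq u <- l | dev_hit u]) F u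
    + \sum_(u <- [seq u <- l | ~~ dev_hit u]) F u.
Proof. by rewrite (bigID dev_hit)/= !big_filter. Qed.

Lemma live_mass K j : \sum_(w <- live K j) m w <= m [::].
Proof.
elim: j => [|j ih].
  rewrite -(level_mass K) [leRHS]split_hit lerDr.
  exact: sumr_ge0.
apply: (le_trans _ ih).
apply: (@le_trans _ _ (\sum_(u <- offspring ch (live K j)) m u)).
  by rewrite [leRHS]split_hit lerDr; exact: sumr_ge0.
rewrite sum_offspring big_seq [leRHS]big_seq; apply: ler_sum => w wl.
by rewrite -(mE (live_level wl)).
Qed.

Hypothesis lam_gt0 : 0 < lam.

(** Chebyshev's inequality: at a hit in generation [n], [lam * n] is below [|tree_dev u|]. *)
Lemma fresh_dev (l : seq (seq I)) n : (0 < n)%N -> {subset l <= level ch n} ->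
  lam ^+ 2 * \sum_(u <- [seq u <- l | dev_hit u]) m u
  <= (\sum_(u <- [seq u <- l | dev_hit u]) m u * tree_dev u ^+ 2) / n%:R ^+ 2.
Proof.
move=> n0 sub; have n1 : 0 < n%:R ^+ 2 :> R by rewrite exprn_gt0// ltr0n.
rewrite mulr_sumr mulr_suml !big_filter big_seq_cond [leRHS]big_seq_cond.
apply: ler_sum => u /andP[ul hit].
rewrite mulrC -mulrA ler_wpM2l// ler_pdivlMr// -exprMn.
rewrite -(real_normK (num_real (tree_dev u))) lerXn2r ?nnegrE ?mulr_ge0//.
  exact: ltW.
by move: hit; rewrite /dev_hit (size_level (sub _ ul)) => /ltW.
Qed.

(* Passing to the next generation adds at most [m [::] * v n / n^2] to the sum of
   [m * (dev / n)^2] over live words, while discarding a hit removes at least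
   [lam^2] times its mass. *)
Lemma hajek_renyi K J : (0 < K)%N ->
  lam ^+ 2 * \sum_(j < J.+1) \sum_(w <- fresh K j) m w
  + (\sum_(w <- live K J) m w * tree_dev w ^+ 2) / (K + J)%:R ^+ 2
  <= m [::] * ((\sum_(1 <= k < K) v k) / K%:R ^+ 2
               + \sum_(K <= k < K + J) v k / k%:R ^+ 2).
Proof.
move=> K0; elim: J => [|J ih].
  rewrite big_ord1 addn0 (big_geq (leqnn K)) addr0.
  have h := @fresh_dev (level ch K) K K0 (fun _ h => h).
  rewrite -[fresh K 0]/[seq u <- level ch K | dev_hit u].
  apply: (le_trans (lerD h (lexx _))).
  rewrite -mulrDl -split_hit mulrA ler_wpM2r ?invr_ge0 ?exprn_ge0//.
  exact: level_dev.
rewrite big_ord_recr/= mulrDr addnS.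
have KJ : (0 < K + J)%N by rewrite addn_gt0 K0.
have sub : {subset offspring ch (live K J) <= level ch (K + J).+1}.
  by apply: sub_offspring; exact: live_level.
have h := fresh_dev (ltn0Sn _) sub.
have s := sublevel_dev_step KJ (@live_level K J) (live_mass K J).
rewrite big_nat_recr ?leq_addr//= addrA mulrDr.
apply: (@le_trans _ _ (lam ^+ 2 * \sum_(i < J.+1) \sum_(w <- fresh K i) m w
   + (\sum_(u <- offspring ch (live K J)) m u * tree_dev u ^+ 2)
       / (K + J).+1%:R ^+ 2)).
  by rewrite -addrA lerD2l [in leRHS]split_hit mulrDl lerD2r.
apply: le_trans (lerD ih (lexx _)).
rewrite -addrA lerD2l mulrA -mulrDl.
(* The larger weight [(K + J)^-2] replaces [(K + J + 1)^-2], so that the one-step bound can be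
   compared with the induction hypothesis. *)
apply: (@le_trans _ _ ((\sum_(u <- offspring ch (live K J)) m u * tree_dev u ^+ 2)
       / (K + J)%:R ^+ 2)).
  apply: ler_wpM2l; first by apply: sumr_ge0 => u _; rewrite mulr_ge0// sqr_ge0.
  by rewrite lef_pV2 ?posrE ?exprn_gt0 ?ltr0n// lerXn2r ?nnegrE// ler_nat.
by rewrite ler_wpM2r// invr_ge0 exprn_ge0.
Qed.

Lemma fresh_mass (C : R) :
  (forall N, \sum_(1 <= k < N) v k / k%:R ^+ 2 <= C) ->
  forall e, 0 < e -> exists2 K, (0 < K)%N &
    forall J, \sum_(j < J) \sum_(w <- fresh K j) m w <= e.
Proof.
move=> bd e e0.
have M0 : 0 < m [::] + 1 by rewrite ltr_wpDl.
(* The summand 1 covers the case of zero total mass. *)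
have e'0 : 0 < lam ^+ 2 * e / (m [::] + 1).
  by rewrite divr_gt0// mulr_gt0// exprn_gt0.
have [K K0 hK] := kronecker_tail v_ge0 bd e'0; exists K => // -[|J].
  by rewrite big_ord0 ltW.
have := hajek_renyi J K0.
have := ler_wpM2l (m_ge0 [::]) (hK J).
have : m [::] * (lam ^+ 2 * e / (m [::] + 1)) <= lam ^+ 2 * e.
  rewrite mulrA ler_pdivrMr// mulrC ler_wpM2l ?lerDl//.
  by rewrite ltW// mulr_gt0// exprn_gt0.
have : 0 <= (\sum_(w <- live K J) m w * tree_dev w ^+ 2) / (K + J)%:R ^+ 2.
  rewrite divr_ge0 ?exprn_ge0//; apply: sumr_ge0 => w _.
  by rewrite mulr_ge0// sqr_ge0.
move=> h1 h2 h3 h4.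
have : lam ^+ 2 * \sum_(j < J.+1) \sum_(w <- fresh K j) m w <= lam ^+ 2 * e.
  by lra.
by rewrite ler_pM2l// exprn_gt0.
Qed.

Lemma restrS (i : nat -> I) n : mkseq i n.+1 = rcons (mkseq i n) (i n).
Proof. by rewrite /mkseq -addn1 iotaD map_cat add0n cats1. Qed.

(** A path that never meets a fresh word stays live in all generations from [K] on, which excludes
    hits there. *)
Lemma hit_fresh (i : nat -> I) K n : (forall n, mkseq i n \in level ch n) ->
  (K <= n)%N -> dev_hit (mkseq i n) ->
  exists j, mkseq i (K + j) \in fresh K j.
Proof.
move=> il Kn hit; apply: contrapT => no.
have nf j : mkseq i (K + j) \notin fresh K j.
  by apply/negP => h; apply: no; exists j.
have lv j : mkseq i (K + j) \in live K j.
  elim: j => [|j ih].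
    by have := nf 0%N; rewrite addn0 !mem_filter il !andbT.
  have := nf j.+1; rewrite !mem_filter addnS restrS mem_offspring ih/=.
  have := il (K + j).+1; rewrite restrS level_rcons => /andP[_ ->].
  by rewrite !andbT.
have := nf (n - K)%N; have := lv (n - K)%N.
case: (n - K)%N (subnKC Kn) => [|j] nE; rewrite nE !mem_filter hit//.
Qed.

End TreeLLN.

(** * Doubling metrics and outer measures *)

Section Metric.
Variables (R : realType) (X : Type) (d : X -> X -> R).
Hypothesis d_metric : is_metric d.

Lemma dist_ge0 x y : 0 <= d x y. Proof. by case: d_metric. Qed.
Lemma dist_sym x y : d x y = d y x. Proof. by case: d_metric. Qed.
Lemma dist_tri y x z : d x z <= d x y + d y z. Proof. by case: d_metric. Qed.

Lemma open_oball x r : open_d d (oball d x r).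
Proof.
move=> y xy; exists (r - d x y); first by rewrite subr_gt0.
move=> z /=; rewrite /oball/= => yz; have := dist_tri y x z; lra.
Qed.

Lemma open_distC x r : open_d d [set y | r < d x y].
Proof.
move=> y /= xy; exists (d x y - r); first by rewrite subr_gt0.
move=> z /=; rewrite /oball/= => yz; have := dist_tri z x y.
rewrite (dist_sym z y); lra.
Qed.

Lemma finite_set_nat_ub (D : set nat) :
  finite_set D -> exists n, forall j, D j -> (j <= n)%N.
Proof.
move=> fD; exists (\max_(j <- finmap.enum_fset (fset_set D)) j)%N => j Dj.
by apply: leq_bigmax_seq => //; rewrite in_fset_set// inE.
Qed.

(** For [x] outside [K], the exteriors of the closed balls of radius [1 / (n + 1)] about [x] cover
    [K]. A finite subcover misses a whole ball about [x]. *)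
Lemma compact_setC_open K : compact_d d K -> open_d d (~` K).
Proof.
move=> cK x Kx.
have [||D fD KD] := cK nat (fun n => [set y | n.+1%:R^-1 < d x y]).
- by move=> n; exact: open_distC.
- move=> y Ky; have xy : 0 < d x y.
    rewrite lt_neqAle dist_ge0 andbT eq_sym; apply/eqP.
    by case: d_metric => _ /(_ x y) [+ _] _ _ => /[apply] xy; apply: Kx; rewrite xy.
  exists (Num.truncn (d x y)^-1) => //=.
  rewrite invf_plt ?posrE ?ltr0n//; exact: truncnS_gt.
have [n hn] := finite_set_nat_ub fD.
exists n.+1%:R^-1; first by rewrite invr_gt0 ltr0n.
move=> y; rewrite /oball/= => xy /KD [j Dj /=]; apply/negP; rewrite -leNgt.
apply: (le_trans (ltW xy)).
by rewrite lef_pV2 ?posrE ?ltr0n// ler_nat ltnS hn.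
Qed.

Lemma compact_borel K : compact_d d K -> borel_d d K.
Proof.
move=> cK; rewrite -[K]setCK -setTD.
apply: sigma_algebraCD; apply: sub_sigma_algebra.
exact: compact_setC_open.
Qed.

Lemma compact_cball K x : compact_d d K -> exists r, K `<=` cball d x r.
Proof.
move=> cK.
have [||D fD KD] := cK nat (fun n => oball d x n.+1%:R).
- by move=> n; exact: open_oball.
- by move=> y Ky; exists (Num.truncn (d x y)) => //; exact: truncnS_gt.
have [n hn] := finite_set_nat_ub fD.
exists n.+1%:R => y /KD [j Dj]; rewrite /oball/cball/= => /ltW xy.
by apply: (le_trans xy); rewrite ler_nat ltnS hn.
Qed.

Lemma compact_dist_le_diam K x y : compact_d d K -> K x -> K y ->
  d x y <= diam d K.
Proof.
move=> cK Kx Ky; have [r hr] := compact_cball x cK.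
apply: ub_le_sup; last by exists x, y.
exists (r + r) => _ [a [b [Ka Kb ->]]].
apply: (le_trans (dist_tri x a b)); rewrite (dist_sym a).
by apply: lerD; exact: hr.
Qed.

Lemma diam_gt0_nonempty K : 0 < diam d K -> exists x, K x.
Proof.
move=> dK; apply: contrapT => nK; move: dK; rewrite /diam.
rewrite (_ : [set _ | _] = set0) ?sup0 ?ltxx//.
by rewrite -subset0 => r [x [y [Kx _ _]]]; apply: nK; exists x.
Qed.

Lemma diam_le K A : compact_d d K -> A `<=` K -> 0 < diam d A ->
  diam d A <= diam d K.
Proof.
move=> cK AK /diam_gt0_nonempty [x Ax].
apply: ge_sup; first by exists (d x x), x, x.
by move=> _ [a [b [Aa Ab ->]]]; apply: compact_dist_le_diam => //; exact: AK.
Qed.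

Lemma size_le_sum_count (T : eqType) (N : nat) (l : seq T)
    (P : 'I_N -> pred T) : (forall w, w \in l -> exists k, P k w) ->
  (size l <= \sum_(k < N) count (P k) l)%N.
Proof.
elim: l => //= w l ih h.
have [k Pk] := h w (mem_head _ _).
have := ih (fun u ul => h u (@mem_behead _ (w :: l) u ul)).
rewrite big_split/= => ih'; rewrite -add1n leq_add//.
by rewrite (bigD1 k)//= Pk.
Qed.

Variable N : nat.
Hypothesis doublingN : forall x r, 0 < r ->
  exists y : 'I_N -> X, cball d x r `<=` \bigcup_(k in setT) cball d (y k) (r / 2).

(** Induction on [t]: each of the [N] covering balls of half the radius carries at most
    [N ^ (t - 1)] of the points. For [t = 0], two points of a ball of radius [r] are never more than
    [2 * r] apart. *)
Lemma separated_size_le t (T : eqType) (l : seq T) (y : T -> X) z r :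
  uniq l -> 0 < r -> (forall w, w \in l -> d z (y w) <= r) ->
  (forall w w', w \in l -> w' \in l -> w != w' ->
     2 * r / 2 ^+ t < d (y w) (y w')) ->
  (size l <= N ^ t)%N.
Proof.
elim: t l z r => [|t ih] l z r ul r0 lr sep.
  case: l ul lr sep => [|w [|w' l]]//= /andP[ww' _] lr sep.
  have := sep w w'; rewrite !inE !eqxx orbT/=.
  rewrite inE negb_or in ww'; case/andP: ww' => ww' _.
  move=> /(_ isT isT ww'); rewrite expr0 divr1 => h.
  have := dist_tri z (y w) (y w'); rewrite (dist_sym _ z).
  have := lr w; have := lr w'; rewrite !inE !eqxx orbT => /(_ isT) h1 /(_ isT) h2.
  lra.
have [c hc] := doublingN z r0.
have cov w : w \in l -> exists k, (fun k w => d (c k) (y w) <= r / 2) k w.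
  by move=> wl; have [k _ hk] := hc _ (lr w wl); exists k.
apply: (leq_trans (size_le_sum_count cov)).
rewrite expnS -[X in (X * _)%N]card_ord -sum_nat_const; apply: leq_sum => k _.
rewrite -size_filter; apply: (ih _ (c k) (r / 2)).
- exact: filter_uniq.
- by rewrite divr_gt0.
- by move=> w; rewrite mem_filter => /andP[].
- move=> w w'; rewrite !mem_filter => /andP[_ wl] /andP[_ wl'] ww'.
  apply: le_lt_trans (sep _ _ wl wl' ww').
  by rewrite exprS invfM !mulrA.
Qed.

End Metric.

(** * Finite additivity, null sets and Borel-Cantelli for outer measures *)

Section OuterMeasureLists.
Variables (R : realType) (X : Type) (mu : {outer_measure set X -> \bar R}).
Local Open Scope ereal_scope.

(** The Caratheodory condition splits off one set at a time; by disjointness the remaining ones lie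
    in [A] minus that set. *)
Lemma outer_sum_le (T : eqType) (l : seq T) (F : T -> set X) (A : set X) :
  uniq l -> (forall a, a \in l -> mu.-caratheodory (F a)) ->
  (forall a, a \in l -> F a `<=` A) ->
  (forall a b, a \in l -> b \in l -> a != b -> F a `&` F b = set0) ->
  \sum_(a <- l) mu (F a) <= mu A.
Proof.
elim: l A => [|a l ih] A /=; first by rewrite big_nil => *; exact: outer_measure_ge0.
move=> /andP[al ul] cF FA dF; rewrite big_cons.
rewrite (cF a (mem_head _ _) A); apply: leeD.
  by apply: le_outer_measure => x ax; split => //; exact: (FA a (mem_head _ _)).
apply: ih => //.
- by move=> b bl; apply: cF; rewrite inE bl orbT.
- move=> b bl x bx; split; first by apply: (FA b) => //; rewrite inE bl orbT.
  move=> ax; have : (F a `&` F b) x by [].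
  rewrite dF ?inE ?eqxx ?bl ?orbT//.
  by apply: contraNneq al => ->.
- by move=> b c bl cl; apply: dF; rewrite inE ?bl ?cl orbT.
Qed.

Lemma outer_le_sum (T : eqType) (l : seq T) (F : T -> set X) (A : set X) :
  (forall x, A x -> exists2 a, a \in l & F a x) ->
  mu A <= \sum_(a <- l) mu (F a).
Proof.
elim: l A => [|a l ih] A AF.
  rewrite big_nil (_ : A = set0) ?outer_measure0//.
  by rewrite -subset0 => x /AF [].
rewrite big_cons; apply: (@le_trans _ _ (mu (F a `|` (A `&` ~` F a)))).
  apply: le_outer_measure => x Ax.
  by have [Fx|Fx] := pselect (F a x); [left|right].
apply: (le_trans (outer_measureU2 _ _ _)); apply: leeD => //.
apply: ih => x [Ax Fx]; have [b] := AF x Ax.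
by rewrite inE => /orP[/eqP-> /Fx//|bl bx]; exists b.
Qed.

Lemma outer_null_sub (A B : set X) : A `<=` B -> mu B = 0 -> mu A = 0.
Proof.
move=> AB B0; apply/eqP; rewrite eq_le outer_measure_ge0 andbT -B0.
exact: le_outer_measure.
Qed.

Lemma outer_null_bigcup (A : nat -> set X) :
  (forall n, mu (A n) = 0) -> mu (\bigcup_n A n) = 0.
Proof.
move=> A0; apply/eqP; rewrite eq_le outer_measure_ge0 andbT.
apply: (le_trans (outer_measure_sigma_subadditive mu A)).
by rewrite eseries0// => n _ _; exact: A0.
Qed.

Lemma outer_nullU (A B : set X) : mu A = 0 -> mu B = 0 -> mu (A `|` B) = 0.
Proof.
move=> A0 B0; apply/eqP; rewrite eq_le outer_measure_ge0 andbT.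
by apply: (le_trans (outer_measureU2 _ _ _)); rewrite A0 B0 adde0.
Qed.

Lemma outer_bigcup_le (A : nat -> set X) (u : nat -> R) (e : R) :
  (forall n, mu (A n) <= (u n)%:E) ->
  (forall J, (\sum_(j < J) u j <= e)%R) ->
  mu (\bigcup_n A n) <= e%:E.
Proof.
move=> Au ue.
apply: (le_trans (outer_measure_sigma_subadditive mu A)).
have A0 n : 0 <= mu (A n) by exact: outer_measure_ge0.
apply: lime_le; first by apply: is_cvg_nneseries => n _ _.
apply: nearW => J; rewrite big_mkord.
apply: (@le_trans _ _ (\sum_(j < J) (u j)%:E)); first exact: lee_sum.
by rewrite sumEFin lee_fin.
Qed.

Lemma outer_le_gt0_null (A : set X) :
  (forall e : R, (0 < e)%R -> mu A <= e%:E) -> mu A = 0.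
Proof.
move=> h; apply/eqP; rewrite eq_le outer_measure_ge0 andbT.
by apply/lee_addgt0Pr => e e0; rewrite add0e; exact: h.
Qed.

(** The limsup set lies in every tail union, whose measure is at most the geometric sum
    [2 C / 2 ^ k]. *)
Lemma outer_borel_cantelli (A : nat -> set X) (C : R) : (0 <= C)%R ->
  (forall l, mu (A l) <= (C / 2 ^+ l)%:E) ->
  mu [set x | forall k, exists2 l, (k <= l)%N & A l x] = 0.
Proof.
move=> C0 hA; apply: outer_le_gt0_null => e e0.
have geo k J : (\sum_(j < J) C / 2 ^+ (k + j) <= 2 * C / 2 ^+ k)%R.
  suff -> : (\sum_(j < J) C / 2 ^+ (k + j) =
      2 * C / 2 ^+ k - 2 * C / 2 ^+ (k + J))%R.
    by rewrite gerBl divr_ge0 ?mulr_ge0 ?exprn_ge0.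
  elim: J => [|J ih]; first by rewrite big_ord0 addn0 subrr.
  rewrite big_ord_recr/= ih addnS exprS; field.
  by rewrite !expf_neq0.
have [k hk] : exists k, (2 * C / 2 ^+ k <= e)%R.
  exists (Num.truncn (e^-1 * (2 * C))).
  rewrite ler_pdivrMr ?exprn_gt0// -ler_pdivrMl//.
  apply: (le_trans (ltW (truncnS_gt _))).
  by rewrite -(natrX R 2) ler_nat; exact: ltn_expl.
apply: (@le_trans _ _ (mu (\bigcup_j A (k + j)%N))).
  apply: le_outer_measure => x /(_ k) [l kl Al].
  by exists (l - k)%N => //; rewrite subnKC.
apply: (@outer_bigcup_le _ (fun j => C / 2 ^+ (k + j))%R) => // J.
exact: le_trans (geo k J) hk.
Qed.

End OuterMeasureLists.

(** * Moran constructions *)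

Section MoranTree.
Variables (R : realType) (X : Type) (d : X -> X -> R) (I : countType).
Variables (Sigma : set (seq I)) (E : seq I -> set X).
Hypothesis d_metric : is_metric d.
Hypothesis tree : is_codetree Sigma.
Hypothesis E_compact : forall w, Sigma w -> compact_d d (E w).
Hypothesis E_diam : forall w, Sigma w -> 0 < diam d (E w).
Hypothesis E_nested : forall w a, Sigma (rcons w a) -> E (rcons w a) `<=` E w.
Hypothesis E_shrink : forall i, Sigma_inf Sigma i ->
  (fun n => diam d (E (restr i n))) @ \oo --> (0 : R).
Hypothesis E_disj : forall w a b, Sigma (rcons w a) -> Sigma (rcons w b) ->
  a <> b -> E (rcons w a) `&` E (rcons w b) = set0.

(** The offspring as a list, which makes the results on weighted trees applicable. *)
Definition kids (w : seq I) : seq I :=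
  finmap.enum_fset (fset_set (children Sigma w)).

Lemma uniq_kids w : uniq (kids w).
Proof. exact: finmap.fset_uniq. Qed.

Lemma finite_children w : finite_set (children Sigma w).
Proof.
case: tree => _ pre off; have [/off[]//|nw] := pselect (Sigma w).
rewrite (_ : children Sigma w = set0)// -subset0 => a /pre; exact: nw.
Qed.

Lemma mem_kids w a : (a \in kids w) <-> Sigma (rcons w a).
Proof.
rewrite /kids in_fset_set; last exact: finite_children.
by split => [/set_mem//|h]; exact: mem_set.
Qed.

Lemma sum_children w (F : I -> R) :
  \sum_(a \in children Sigma w) F a = \sum_(a <- kids w) F a.
Proof. by rewrite fsbig_finite//; exact: finite_children. Qed.

Lemma mem_level n w : (w \in level kids n) <-> Sigma_n Sigma n w.
Proof.
case: tree => S0 pre _; elim: n w => [|n ih] w.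
  rewrite inE; split => [/eqP->|[_ /size0nil->]]//.
case: (lastP w) => [|u a].
  by split => [/size_level|[_]].
rewrite level_rcons; split => [/andP[/ih [Su su] /mem_kids Sa]|[Sa]].
  by split; rewrite ?size_rcons ?su.
rewrite size_rcons => -[su]; apply/andP; split; last exact/mem_kids.
by apply/ih; split => //; exact: pre Sa.
Qed.

Lemma level_Sigma n w : w \in level kids n -> Sigma w.
Proof. by move/mem_level => []. Qed.

Lemma Sigma_level w : Sigma w -> w \in level kids (size w).
Proof. by move=> Sw; apply/mem_level. Qed.

Lemma Sigma_inf_level i : Sigma_inf Sigma i -> forall n, restr i n \in level kids n.
Proof. by move=> Si n; apply/mem_level; split; [exact: Si|rewrite size_mkseq]. Qed.

Lemma E_take w k : Sigma w -> E w `<=` E (take k w).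
Proof.
case: tree => _ pre _; elim/last_ind: w => [_|w a ih Sw]; first by move=> x; case: k.
have [kw|kw] := leqP k (size w); last by rewrite take_oversize ?size_rcons.
rewrite -cats1 takel_cat// cats1.
by apply: subset_trans (ih (pre _ _ Sw)); exact: E_nested.
Qed.

Lemma diam_take w k : Sigma w -> diam d (E w) <= diam d (E (take k w)).
Proof.
move=> Sw; have Sk : Sigma (take k w).
  have [kw|kw] := leqP k (size w); last by rewrite take_oversize// ltnW.
  by apply: level_Sigma; apply: take_level kw; exact: Sigma_level.
by apply: diam_le; [exact: d_metric|exact: E_compact|exact: E_take|exact: E_diam].
Qed.

Lemma level_disj n w w' x : w \in level kids n -> w' \in level kids n ->
  E w x -> E w' x -> w = w'.
Proof.
elim: n w w' => [|n ih] w w'; first by rewrite !inE => /eqP-> /eqP->.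
case: (lastP w) => [/size_level//|u a]; case: (lastP w') => [_ /size_level//|u' b].
rewrite !level_rcons => /andP[ul /mem_kids Sa] /andP[ul' /mem_kids Sb] xa xb.
have uu : u = u' by apply: ih => //; [apply: E_nested xa|apply: E_nested xb].
subst u'; congr rcons; apply: contrapT => ab.
suff : (E (rcons u a) `&` E (rcons u b)) x by rewrite E_disj.
by split.
Qed.

Lemma limit_level x n : limit_set Sigma E x -> exists2 w, w \in level kids n & E w x.
Proof. by move=> /(_ n Logic.I) [w /mem_level wl wx]; exists w. Qed.

Lemma children_inh : inhabited I.
Proof. by case: tree => S0 _ /(_ _ S0) [_ [a _]]. Qed.

Lemma path_of_words (W : nat -> seq I) : (forall n, W n \in level kids n) ->
  (forall n, take n (W n.+1) = W n) ->
  exists2 i, Sigma_inf Sigma i & forall n, restr i n = W n.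
Proof.
move=> Wl Wt; have [a0] := children_inh.
have iE n : restr (fun n => nth a0 (W n.+1) n) n = W n.
  elim: n => [|n ih]; first by have /size_level/size0nil-> := Wl 0%N.
  rewrite /restr restrS -/(restr _ n) ih -[W n in LHS]Wt -take_nth ?take_oversize//;
  by rewrite (size_level (Wl n.+1)).
exists (fun n => nth a0 (W n.+1) n) => // n.
by rewrite iE; exact: level_Sigma (Wl n).
Qed.

(** By disjointness, each generation has only one word whose set contains [x]; hence these words
    extend one another. *)
Lemma limit_path x : limit_set Sigma E x ->
  exists2 i, Sigma_inf Sigma i & forall n, E (restr i n) x.
Proof.
move=> Lx.
have /choice [W hW] : forall n, exists w, w \in level kids n /\ E w x.
  by move=> n; have [w wl wx] := limit_level n Lx; exists w.
have [n|n|i Si iE] := @path_of_words W.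
- by case: (hW n).
- have [Wl Wx] := hW n.+1; have [Wl' Wx'] := hW n.
  apply: (level_disj _ Wl' _ Wx'); first by apply: take_level Wl _.
  by apply: E_take Wx; exact: level_Sigma Wl.
by exists i => // n; rewrite iE; case: (hW n).
Qed.

(* Koenig's lemma turns the pointwise condition (M2) into uniform smallness. *)
Lemma level_diam_small r : 0 < r ->
  exists n, forall w, w \in level kids n -> diam d (E w) <= r.
Proof.
move=> r0; apply: contrapT => no.
(* Bad words have descendants of diameter above [r] at every depth. The root is bad and badness
   passes to some child, so an infinite path contradicts (M2). *)
pose bad w := forall k, exists u, [/\ u \in level kids (size w + k),
  take (size w) u = w & r < diam d (E u)].
have bad0 : bad [::].
  move=> k; apply: contrapT => nu; apply: no; exists k => w wl.
  rewrite leNgt; apply/negP => rw; apply: nu; exists w; split => //.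
  by rewrite take0.
have bad_ext w : bad w -> exists a, bad (rcons w a).
  move=> bw; apply: contrapT => nb.
  have /choice [k hk] : forall a, exists k, ~ exists u,
      [/\ u \in level kids (size (rcons w a) + k),
      take (size (rcons w a)) u = rcons w a & r < diam d (E u)].
    move=> a; apply: contrapT => nk; apply: nb; exists a => k.
    by apply: contrapT => nu; apply: nk; exists k.
  (* This depth dominates every [k a]. Truncating a large descendant at depth [K.+1] gives one at
     depth [k a] below its own child [a], and truncation does not decrease the diameter. *)
  pose K := (\sum_(a <- kids w) k a)%N.
  have [u [ul uw ru]] := bw K.+1.
  have su := size_level ul.
  have [a0] := children_inh.
  pose a := nth a0 u (size w).
  have ua : take (size w).+1 u = rcons w a.
    by rewrite (take_nth a0) ?uw// su addnS ltnS leq_addr.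
  have aw : a \in kids w.
    have : take (size w).+1 u \in level kids (size w).+1.
      by apply: take_level ul _; rewrite addnS ltnS leq_addr.
    by rewrite ua level_rcons => /andP[].
  have kK : (k a <= K)%N by rewrite /K (big_rem a)//= leq_addr.
  apply: (hk a); exists (take ((size w).+1 + k a) u); split.
  - by rewrite size_rcons; apply: take_level ul _; rewrite addSn addnS ltnS leq_add2l.
  - by rewrite size_rcons take_takel// leq_addr.
  - by apply: (lt_le_trans ru); apply: diam_take; exact: level_Sigma ul.
have /choice [f hf] : forall w, exists a, bad w -> bad (rcons w a).
  move=> w; have [/bad_ext[a ba]|nb] := pselect (bad w).
    by exists a.
  by have [a0] := children_inh; exists a0.
pose W n := iter n (fun w => rcons w (f w)) [::].
have Wb n : bad (W n) by elim: n => //= n; exact: hf.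
have sW n : size (W n) = n by elim: n => //= n ih; rewrite size_rcons ih.
have Wl n : W n \in level kids n /\ r < diam d (E (W n)).
  have [u [ul]] := Wb n 0%N; rewrite addn0 sW in ul.
  by rewrite sW take_oversize ?(size_level ul)// => <-.
have [n|n|i Si iE] := @path_of_words W.
- by case: (Wl n).
- by rewrite /= -cats1 take_size_cat.
have /cvgrPdist_lt/(_ _ r0) [n _ /(_ n (leqnn n))] := E_shrink Si.
rewrite /= iE sub0r normrN ltNge => /negP; apply.
by rewrite (le_trans _ (ler_norm _))// ltW//; case: (Wl n).
Qed.

(** * Masses of cylinders and balls *)

Variable mu : {outer_measure set X -> \bar R}.
Hypothesis mu_meas : is_measure_d d mu.
Hypothesis mu_full : mu (~` limit_set Sigma E) = 0%E.

Definition mass (w : seq I) : R := fine (mu (E w)).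

Lemma mass_ge0 w : 0 <= mass w.
Proof. by rewrite fine_ge0// outer_measure_ge0. Qed.

Lemma E_mass w : Sigma w -> mu (E w) = (mass w)%:E.
Proof.
move=> Sw; rewrite /mass fineK//.
case: mu_meas => _ _ _ fin; rewrite ge0_fin_numE ?outer_measure_ge0// fin//.
have [x _] := diam_gt0_nonempty (E_diam Sw).
by have [r hr] := compact_cball d_metric x (E_compact Sw); exists x, r.
Qed.

Lemma outer_limitI A : mu A = mu (A `&` limit_set Sigma E).
Proof.
apply/eqP; rewrite eq_le; apply/andP; split; last first.
  by apply: le_outer_measure; exact: subIsetl.
apply: (le_trans (le_outer_measureIC mu (limit_set Sigma E) A)).
rewrite [X in (_ + X)%E](@outer_null_sub _ _ mu _ (~` limit_set Sigma E)) ?adde0//.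
Qed.

(** Only the part of [A] in the limit set counts, and it is covered by the generation [n] cylinders
    that meet [A]. *)
Lemma outer_le_mass n (P : pred (seq I)) (A : set X) :
  (forall w x, w \in level kids n -> A x -> E w x -> P w) ->
  (mu A <= (\sum_(w <- level kids n | P w) mass w)%:E)%E.
Proof.
move=> AP; rewrite outer_limitI.
have -> : (\sum_(w <- level kids n | P w) mass w)%:E =
    (\sum_(w <- [seq w <- level kids n | P w]) mu (E w))%E.
  rewrite -sumEFin -big_filter big_seq [RHS]big_seq.
  apply: eq_bigr => w; rewrite mem_filter => /andP[_ wl].
  by rewrite E_mass//; exact: level_Sigma wl.
apply: outer_le_sum => x [Ax /(limit_level n) [w wl wx]].
by exists w => //; rewrite mem_filter wl (AP w x).
Qed.

(** One inequality holds because the children cover the part of [E w] in the limit set, which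
    carries [mu]; the other because they are disjoint and compact, hence Borel and Caratheodory
    measurable. *)
Lemma mass_children n w : w \in level kids n ->
  mass w = \sum_(a <- kids w) mass (rcons w a).
Proof.
move=> wl; have Sw := level_Sigma wl.
have sumE : (\sum_(a <- kids w) mass (rcons w a))%:E =
    (\sum_(a <- kids w) mu (E (rcons w a)))%E.
  rewrite -sumEFin big_seq [RHS]big_seq; apply: eq_bigr => a /mem_kids Sa.
  by rewrite E_mass.
apply/eqP; rewrite eq_le -!lee_fin sumE -E_mass//; apply/andP; split.
- rewrite outer_limitI; apply: outer_le_sum => x [wx].
  move=> /(limit_level n.+1) [u]; case: (lastP u) => [/size_level//|v a].
  rewrite level_rcons => /andP[vl /[dup] av /mem_kids Sa] vx.
  by have wv := level_disj wl vl wx (E_nested Sa vx); exists a; rewrite wv.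
- apply: outer_sum_le; first exact: uniq_kids.
  + move=> a /mem_kids Sa; case: mu_meas => _ + _ _; apply.
    by apply: compact_borel => //; exact: E_compact.
  + by move=> a /mem_kids; exact: E_nested.
  + by move=> a b /mem_kids Sa /mem_kids Sb /eqP; exact: E_disj.
Qed.

Lemma Sigma_nil : Sigma [::]. Proof. by case: tree. Qed.

Lemma outer_le_total A : (mu A <= (mass [::])%:E)%E.
Proof.
rewrite -(level_mass mass_children 0).
exact: (@outer_le_mass 0 xpredT).
Qed.

Definition ball_mass (x : X) (r : R) : R := fine (mu (cball d x r)).

Lemma ball_massE x r : mu (cball d x r) = (ball_mass x r)%:E.
Proof.
rewrite /ball_mass fineK// ge0_fin_numE ?outer_measure_ge0//.
exact: le_lt_trans (outer_le_total _) (ltry _).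
Qed.

Lemma ball_mass_le x r s : r <= s -> ball_mass x r <= ball_mass x s.
Proof.
move=> rs; rewrite -lee_fin -!ball_massE; apply: le_outer_measure => y.
by rewrite /cball/= => /le_trans; apply.
Qed.

Lemma mass_le_ball w x : Sigma w -> E w x -> mass w <= ball_mass x (diam d (E w)).
Proof.
move=> Sw wx; rewrite -lee_fin -ball_massE -E_mass//; apply: le_outer_measure => y wy.
by apply: compact_dist_le_diam => //; exact: E_compact.
Qed.

Lemma null_mass_paths :
  mu [set x | exists n w, [/\ w \in level kids n, mass w = 0 & E w x]] = 0%E.
Proof.
apply: outer_null_sub (outer_null_bigcup
  (A := fun n => [set x | exists w, [/\ w \in level kids n, mass w = 0 & E w x]]) _).
  by move=> x [n h]; exists n.
move=> n; apply/eqP; rewrite eq_le outer_measure_ge0 andbT.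
apply: (le_trans (@outer_le_mass n (fun w => mass w == 0) _ _)).
  by move=> w x wl [u [ul u0 ux]] wx; rewrite (level_disj wl ul wx ux) u0.
by rewrite big1// => w /eqP.
Qed.



(** * The strong law along almost every path *)

Section StrongLaw.
Variables (Z : seq I -> R) (v : nat -> R) (C : R).
Hypothesis v_ge0 : forall k, 0 <= v k.
Hypothesis msq_le : forall n w, (0 < n)%N -> w \in level kids n ->
  tree_msq kids mass Z w <= v n.
Hypothesis v_sum : forall N, \sum_(1 <= k < N) v k / k%:R ^+ 2 <= C.

(** A path with hits in arbitrarily late generations passes through a fresh word, and for suitable
    [K] the fresh words have total mass at most [e]. *)
Lemma dev_hit_null lam : 0 < lam ->
  mu [set x | exists i, [/\ Sigma_inf Sigma i, forall n, E (restr i n) x &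
    forall K, exists2 n, (K <= n)%N & dev_hit kids mass Z lam (restr i n)]] = 0%E.
Proof.
move=> lam0; apply: outer_le_gt0_null => e e0.
have [K K0 hK] := fresh_mass mass_ge0 mass_children v_ge0 msq_le lam0 v_sum e0.
pose F j := [set x | exists2 w, w \in fresh kids mass Z lam K j & E w x].
apply: (@le_trans _ _ (mu (\bigcup_j F j))).
  apply: le_outer_measure => x [i [Si ix /(_ K) [n Kn hit]]].
  have [j hj] := hit_fresh (Sigma_inf_level Si) Kn hit.
  by exists j => //; exists (restr i (K + j)).
apply: (outer_bigcup_le
  (u := fun j => \sum_(w <- fresh kids mass Z lam K j) mass w)) hK => j.
have -> : (\sum_(w <- fresh kids mass Z lam K j) mass w)%:E =
    (\sum_(w <- fresh kids mass Z lam K j) mu (E w))%E; last first.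
  by apply: outer_le_sum => x [w wf wx]; exists w.
rewrite -sumEFin big_seq [RHS]big_seq; apply: eq_bigr => w wf.
by rewrite E_mass//; exact: level_Sigma (fresh_level wf).
Qed.

Lemma strong_law_null :
  mu [set x | exists i lam, [/\ Sigma_inf Sigma i, forall n, E (restr i n) x,
    0 < lam & forall K, exists2 n, (K <= n)%N &
      dev_hit kids mass Z lam (restr i n)]] = 0%E.
Proof.
have pos j : 0 < j.+1%:R^-1 :> R by rewrite invr_gt0 ltr0n.
apply: outer_null_sub (outer_null_bigcup (fun j => dev_hit_null (pos j))).
move=> x [i [lam [Si ix lam0 hit]]].
exists (Num.truncn lam^-1) => //; exists i; split => // K.
have [n Kn hn] := hit K; exists n => //.
apply: le_lt_trans hn; rewrite ler_wpM2r//.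
by rewrite invf_ple ?posrE ?ltr0n// ltW// truncnS_gt.
Qed.

End StrongLaw.

(** * Cylinders much lighter than the balls around them *)

Section Balls.
Variables (N : nat) (C0 : R).
Hypothesis doublingN : forall x r, 0 < r ->
  exists y : 'I_N -> X, cball d x r `<=` \bigcup_(k in setT) cball d (y k) (r / 2).
Hypothesis C0_gt0 : 0 < C0.
Hypothesis E_ball : forall w, Sigma w ->
  exists2 x, E w x & cball d x (C0 * diam d (E w)) `<=` E w.

Variables (s t0 : nat).
Hypothesis N_le : (N <= 2 ^ s)%N.
Hypothesis t0_le : C0^-1 <= 2 ^+ t0.

(* The scales are powers of [2 ^ h], so that the radius [2 ^- (h.-1 * l)] is at
   least [diam ^ (1 - 1/h)] without real exponents; [E w] carries much less mass
   than this ball. *)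
Definition heavy_ball (h l : nat) (w : seq I) (x : X) : Prop :=
  [/\ E w x, 2 ^- (h * l.+1) < diam d (E w), diam d (E w) <= 2 ^- (h * l) &
      2 ^+ (s.+2 * l) * mass w < ball_mass x (2 ^- (h.-1 * l))].

(** The balls of (M4) inside disjoint cylinders have centres more than [C0 * 2 ^- (h * l.+1)] apart,
    all within [4 * rho] of [z]; doubling bounds their number. *)
Lemma heavy_count h l n (x : seq I -> X) (z : X) (L : seq (seq I)) : (0 < h)%N ->
  {subset L <= level kids n} -> uniq L ->
  (forall w, w \in L -> heavy_ball h l w (x w) /\ d z (x w) <= 2 * 2 ^- (h.-1 * l)) ->
  (size L <= N ^ (l + h + 3 + t0))%N.
Proof.
move=> h0 Ll uL hL; set rho : R := 2 ^- (h.-1 * l).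
have rho0 : 0 < rho by rewrite invr_gt0 exprn_gt0.
have /choice [y hy] : forall w, exists y, Sigma w ->
    E w y /\ cball d y (C0 * diam d (E w)) `<=` E w.
  move=> w; have [/E_ball [y wy yw]|nS] := pselect (Sigma w); first by exists y.
  by have [y _ _] := E_ball Sigma_nil; exists y.
apply: (separated_size_le d_metric doublingN (y := y) (z := z) (r := 4 * rho)) => //.
- by rewrite mulr_gt0.
- move=> w wL; have [[wx _ D1 _] zx] := hL w wL.
  have Sw := level_Sigma (Ll _ wL); have [wy _] := hy _ Sw.
  have D2 := compact_dist_le_diam d_metric (E_compact Sw) wx wy.
  have D3 : 2 ^- (h * l) <= rho.
    by rewrite lef_pV2 ?posrE ?exprn_gt0// ler_weXn2l ?ler1n// leq_mul2r leq_pred orbT.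
  apply: (le_trans (dist_tri d_metric (x w) z (y w))).
  apply: (le_trans (lerD zx (le_trans D2 (le_trans D1 D3)))).
  by rewrite -/rho; lra.
- move=> w w' wL wL' ww'.
  have [[_ D0 _ _] _] := hL w wL.
  have [wy yw] := hy _ (level_Sigma (Ll _ wL)).
  have [wy' _] := hy _ (level_Sigma (Ll _ wL')).
  have : ~ d (y w) (y w') <= C0 * diam d (E w).
    move=> /yw yw'; move/eqP: ww'; apply.
    exact: level_disj (Ll _ wL) (Ll _ wL') yw' wy'.
  move/negP; rewrite -ltNge; apply: le_lt_trans.
  apply: (@le_trans _ _ (C0 * 2 ^- (h * l.+1))); last by rewrite ler_pM2l// ltW.
  rewrite -lef_pV2 ?posrE ?divr_gt0 ?mulr_gt0 ?exprn_gt0 ?invr_gt0 ?exprn_gt0//.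
  rewrite !invfM !invrK.
  (* In the exponent, [l + h] is the gap between [h.-1 * l] and [h * l.+1], [3] cancels the factor
     8, and [t0] pays for [C0]. *)
  have -> : (2 : R)^-1 * (4^-1 * 2 ^+ (h.-1 * l)) * 2 ^+ (l + h + 3 + t0) =
     2 ^+ t0 * 2 ^+ (h * l.+1).
    have -> : (h * l.+1 = h.-1 * l + l + h)%N by rewrite -mulSnr prednK// mulnS addnC.
    by rewrite !exprD; field.
  by rewrite ler_wpM2r// exprn_ge0.
Qed.

(** Double counting: a heavy word has mass at most [2 ^- (s.+2 * l)] times that of its ball, which
    is covered by fine cylinders. Each of these serves at most [2 ^ (s * (l + h + 3 + t0))] heavy
    words, and a factor [2 ^- (2 * l)] survives. *)
Lemma heavy_mass h l n : (0 < h)%N ->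
  \sum_(w <- level kids n | `[< exists x, heavy_ball h l w x >]) mass w
    <= mass [::] * 2 ^+ (s * (h + 3 + t0)) / 2 ^+ (2 * l).
Proof.
move=> h0; set rho : R := 2 ^- (h.-1 * l).
have rho0 : 0 < rho by rewrite invr_gt0 exprn_gt0.
(* At generation [j] a cylinder meeting the ball of radius [rho] about [x w] lies within [2 * rho]
   of [x w]. *)
have [j hj] := level_diam_small rho0.
have /choice [x hx] : forall w, exists x, (exists x, heavy_ball h l w x) ->
    heavy_ball h l w x.
  move=> w; have [[x wx]|nb] := pselect (exists x, heavy_ball h l w x).
    by exists x.
  by have [y _ _] := E_ball Sigma_nil; exists y.
pose P w v := `[< exists z, E v z /\ d (x w) z <= rho >].
pose B w := `[< exists x, heavy_ball h l w x >].
have step w : B w ->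
    mass w <= 2 ^- (s.+2 * l) * \sum_(v <- level kids j | P w v) mass v.
  move=> /asboolP /hx [_ _ _ hw].
  rewrite ler_pdivlMl ?exprn_gt0//; apply: (le_trans (ltW hw)).
  rewrite -lee_fin -ball_massE; apply: outer_le_mass => v z vl xz vz.
  by apply/asboolP; exists z.
apply: (@le_trans _ _ (\sum_(w <- level kids n | B w)
    2 ^- (s.+2 * l) * \sum_(v <- level kids j | P w v) mass v)).
  exact: ler_sum.
rewrite -mulr_sumr (exchange_big_dep xpredT)//=.
have cnt v : v \in level kids j -> \sum_(w <- level kids n | B w && P w v) mass v
    <= mass v * 2 ^+ (s * (l + h + 3 + t0)).
  move=> vl; have [z vz] := diam_gt0_nonempty (E_diam (level_Sigma vl)).
  rewrite big_const_seq iter_addr_0 -[_ *+ count _ _]mulr_natr ler_wpM2l ?mass_ge0//.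
  rewrite -natrX ler_nat -size_filter expnM.
  apply: (@leq_trans (N ^ (l + h + 3 + t0))); last by rewrite leq_exp2r// addnS.
  apply: (@heavy_count h l n x z) => //.
  - by move=> w; rewrite mem_filter => /andP[].
  - by apply: filter_uniq; apply: uniq_level; exact: uniq_kids.
  - move=> w; rewrite mem_filter => /andP[/andP[/asboolP/hx Bw /asboolP[u [vu xu]]] _].
    split => //.
    have := dist_tri d_metric u z (x w); rewrite (dist_sym d_metric u).
    have := compact_dist_le_diam d_metric (E_compact (level_Sigma vl)) vz vu.
    have := hj _ vl; rewrite -/rho; lra.
apply: (@le_trans _ _ (2 ^- (s.+2 * l) *
    \sum_(v <- level kids j) mass v * 2 ^+ (s * (l + h + 3 + t0)))).
  rewrite ler_wpM2l ?invr_ge0 ?exprn_ge0//.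
  by rewrite big_seq [leRHS]big_seq; exact: ler_sum.
rewrite -mulr_suml (level_mass mass_children).
have -> : (s * (l + h + 3 + t0) = s * l + s * (h + 3 + t0))%N.
  by rewrite -mulnDr !addnA.
have -> : (s.+2 * l = s * l + 2 * l)%N by rewrite -mulnDl addn2.
rewrite !exprD le_eqVlt; apply/orP; left; apply/eqP; field.
by rewrite !expf_neq0.
Qed.

(** For fixed [h] and [L], at most [L * l + 1] generations contribute at scale [l], each at most a
    constant times [4 ^- l]. The sum is [O(2 ^- l)], and Borel-Cantelli applies. *)
Lemma heavy_null : mu [set x | exists h L, (0 < h)%N /\ forall k,
   exists2 l, (k <= l)%N & exists n w, [/\ (n <= L * l)%N, w \in level kids n &
     heavy_ball h l w x]] = 0%E.
Proof.
pose A h L l := [set x | exists n w, [/\ (n <= L * l)%N, w \in level kids n &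
     heavy_ball h.+1 l w x]].
apply: (@outer_null_sub _ _ _ _ (\bigcup_h \bigcup_L
   [set x | forall k, exists2 l, (k <= l)%N & A h L l x])).
  move=> x [h [L [h0 hx]]]; exists h.-1 => //; exists L => // k.
  by have [l kl hl] := hx k; exists l => //; rewrite /A prednK.
apply: outer_null_bigcup => h; apply: outer_null_bigcup => L.
pose K : R := mass [::] * 2 ^+ (s * (h.+1 + 3 + t0)).
have K0 : 0 <= K by rewrite mulr_ge0 ?mass_ge0// exprn_ge0.
apply: (@outer_borel_cantelli _ _ mu _ (L.+1%:R * K)).
  by rewrite mulr_ge0.
move=> l.
apply: (@le_trans _ _ (mu (\bigcup_n [set x | (n <= L * l)%N /\
    exists2 w, w \in level kids n & heavy_ball h.+1 l w x]))).
  apply: le_outer_measure => x [n [w [nL wl wx]]].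
  by exists n => //; split => //; exists w.
apply: (@outer_bigcup_le _ _ _ _
  (fun n => if (n <= L * l)%N then K / 2 ^+ (2 * l) else 0)).
  move=> n; case: ifPn => nL; last first.
    rewrite (_ : [set _ | _] = set0) ?outer_measure0//.
    by rewrite -subset0 => x []; rewrite ?(negbTE nL).
  apply: le_trans (_ : _ <= (\sum_(w <- level kids n |
    `[< exists x, heavy_ball h.+1 l w x >]) mass w)%:E)%E _; last first.
    by rewrite lee_fin heavy_mass.
  apply: outer_le_mass => w x wl [_ [u ul hx]] wx.
  have uw : u = w by case: hx => ux _ _ _; exact: level_disj ul wl ux wx.
  by apply/asboolP; exists x; rewrite -uw.
move=> J; rewrite -big_mkcond/=.
apply: (@le_trans _ _ (\sum_(i < (L * l).+1) K / 2 ^+ (2 * l))).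
  rewrite !sumr_const -[_ *+ #|_| in leLHS]mulr_natr.
  rewrite -[_ *+ #|_| in leRHS]mulr_natr ler_wpM2l ?divr_ge0 ?exprn_ge0// ler_nat.
  rewrite card_ord -[X in (_ <= X)%N](size_iota 0).
  rewrite cardE -(size_map val); apply: uniq_leq_size.
    by rewrite map_inj_uniq ?enum_uniq//; exact: val_inj.
  by move=> _ /mapP [i + ->]; rewrite mem_enum mem_iota add0n ltnS.
rewrite sumr_const card_ord -[_ *+ (L * l).+1]mulr_natr.
have two0 : (2 : R) ^+ l != 0 by rewrite expf_neq0.
have -> : K / 2 ^+ (2 * l) * (L * l).+1%:R =
    K / 2 ^+ l * ((L * l).+1%:R / 2 ^+ l).
  by rewrite mulnC exprM; field.
have -> : L.+1%:R * K / 2 ^+ l = K / 2 ^+ l * L.+1%:R by field.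
rewrite ler_wpM2l ?divr_ge0 ?exprn_ge0// ler_pdivrMr ?exprn_gt0//.
rewrite -natrX -natrM ler_nat.
apply: (@leq_trans (L.+1 * l.+1)%N).
  by rewrite mulSn mulnS; lia.
by rewrite leq_mul2l ltn_expl// orbT.
Qed.

End Balls.


(** * Logarithmic upper bounds for ball masses *)

Lemma ln_half_pow k : ln (2 ^- k) = - (k%:R * ln 2) :> R.
Proof. by rewrite lnV ?posrE ?exprn_gt0// lnXn// mulr_natl. Qed.

Lemma ln2_gt0 : 0 < ln 2 :> R.
Proof. by rewrite ln_gt0// ltr1n. Qed.

Lemma dyadic_scale (D : R) h : 0 < D -> D <= 1 -> (0 < h)%N ->
  exists l, 2 ^- (h * l.+1) < D /\ D <= 2 ^- (h * l).
Proof.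
move=> D0 D1 h0; have l2 := ln2_gt0.
have lD : ln D <= 0 by rewrite ln_le0.
have hl : 0 < h%:R * ln 2 :> R by rewrite mulr_gt0// ltr0n.
have p k : (2 : R) ^- k \is Num.pos by rewrite posrE invr_gt0 exprn_gt0.
have q0 : 0 <= - ln D / (h%:R * ln 2) by rewrite divr_ge0 ?oppr_ge0// ltW.
have /andP[t1 t2] := truncn_itv q0.
exists (Num.truncn (- ln D / (h%:R * ln 2))).
rewrite -ltr_ln ?posrE// -ler_ln ?posrE// !ln_half_pow !natrM.
move: t1 t2; rewrite ler_pdivlMr// ltr_pdivrMr// => t1 t2.
by split; lra.
Qed.

(** Let [l] be the scale with [D] between [2 ^- (h * l.+1)] and [2 ^- (h * l)]. The ball of radius
    [r] lies in that of radius [2 ^- (h.-1 * l)], and since the cylinder is not heavy the loss is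
    [s.+2 * l * ln 2], at most [s.+2 / h] times [- ln D]. *)
Lemma ball_mass_upper s (c : R) i x : 0 < c ->
  (exists n0, forall n, (n0 <= n)%N -> c * n%:R <= - ln (diam d (E (restr i n)))) ->
  Sigma_inf Sigma i -> (forall n, E (restr i n) x) ->
  (forall n, 0 < mass (restr i n)) ->
  ~ (exists h L, (0 < h)%N /\ forall k,
     exists2 l, (k <= l)%N & exists n w, [/\ (n <= L * l)%N, w \in level kids n &
       heavy_ball s h l w x]) ->
  forall h, (0 < h)%N -> exists n0, forall n, (n0 <= n)%N -> forall r,
     0 < r -> 0 < ball_mass x r ->
     ln r <= (1 - h%:R^-1) * ln (diam d (E (restr i n))) ->
     ln (ball_mass x r) <= ln (mass (restr i n))
       + s.+2%:R * h%:R^-1 * - ln (diam d (E (restr i n))).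
Proof.
move=> c0 [n1 hc] Si ix im nh h h0; have l2 := ln2_gt0.
(* From [c * n <= - ln D < h * (l + 1) * ln 2] and [l >= 1] follows [n <= q * l]. *)
pose q : R := 2 * h%:R * ln 2 / c.
pose L := (Num.truncn q).+1.
have [k hk] : exists k, forall l, (k <= l)%N -> forall n w,
    (n <= L * l)%N -> w \in level kids n -> ~ heavy_ball s h l w x.
  apply: contrapT => nk; apply: nh; exists h, L; split => // k.
  apply: contrapT => nl; apply: nk; exists k => l kl n w nL wl hb.
  by apply: nl; exists l => //; exists n, w.
(* A diameter below this threshold has scale [l > k], so heaviness is excluded there. *)
have /cvgrPdist_lt/(_ (2 ^- (h * k.+1))) := E_shrink Si.
rewrite invr_gt0 exprn_gt0// => /(_ isT) [n2 _ hn2].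
exists (maxn n1 n2) => n; rewrite geq_max => /andP[/hc cn /hn2 /=].
set D := diam d (E (restr i n)) in cn *.
have D0 : 0 < D by apply: E_diam; exact: Si.
rewrite sub0r normrN gtr0_norm// => Dk r r0 b0 lr.
have hp : 0 < h%:R :> R by rewrite ltr0n.
have D1 : D <= 1.
  by apply: ltW; apply: (lt_le_trans Dk); rewrite invf_le1 ?exprn_gt0// exprn_ege1// ler1n.
have [l [lD Dl]] := dyadic_scale D0 D1 h0.
have kl : (k < l)%N.
  rewrite ltnNge; apply/negP => lk; have := lt_trans lD Dk.
  rewrite ltf_pV2 ?posrE ?exprn_gt0// ltr_eXn2l ?ltr1n// ltn_mul2l h0/= ltnS.
  by rewrite ltnNge lk.
have p j : (2 : R) ^- j \is Num.pos by rewrite posrE invr_gt0 exprn_gt0.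
have lD' : - ln D < h%:R * l.+1%:R * ln 2.
  by move: lD; rewrite -ltr_ln ?posrE// ln_half_pow natrM; lra.
have Dl' : h%:R * l%:R * ln 2 <= - ln D.
  by move: Dl; rewrite -ler_ln ?posrE// ln_half_pow natrM; lra.
have nL : (n <= L * l)%N.
  have l1 : 1 <= l%:R :> R by rewrite ler1n (leq_ltn_trans (leq0n k)).
  have : c * n%:R <= 2 * h%:R * ln 2 * l%:R.
    have : 0 <= h%:R * ln 2 * (l%:R - 1) :> R.
      by apply: mulr_ge0; rewrite ?subr_ge0//; apply: mulr_ge0 => //; exact: ltW.
    by move: lD'; rewrite -natr1; lra.
  rewrite mulrC -ler_pdivlMr// -(ler_nat R) natrM => hn.
  apply: (le_trans hn); rewrite mulrAC -/q ler_wpM2r//.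
  by rewrite /L ltW// truncnS_gt.
have nb : ball_mass x (2 ^- (h.-1 * l)) <= 2 ^+ (s.+2 * l) * mass (restr i n).
  rewrite leNgt; apply/negP => hb.
  by apply: (hk l (ltnW kl) n (restr i n) nL (Sigma_inf_level Si n)).
have rr : r <= 2 ^- (h.-1 * l).
  rewrite -ler_ln ?posrE// ln_half_pow natrM; apply: (le_trans lr).
  have -> : h.-1%:R = h%:R - 1 :> R by rewrite -[in RHS](prednK h0) -natr1 addrK.
  have : 0 <= (1 - h%:R^-1) * (- ln D - h%:R * l%:R * ln 2).
    by rewrite mulr_ge0 ?subr_ge0// invf_le1// ler1n.
  have : h%:R^-1 * (h%:R * l%:R * ln 2) = l%:R * ln 2 :> R.
    by field; rewrite gt_eqF.
  lra.
have b1 := ball_mass_le x rr.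
have : ln (ball_mass x r) <= ln (2 ^+ (s.+2 * l) * mass (restr i n)).
  have b2 := le_trans b1 nb.
  by rewrite ler_ln ?posrE// (lt_le_trans b0 b2).
rewrite lnM ?posrE ?exprn_gt0// lnXn// => /le_trans; apply.
rewrite addrC lerD2l -[_ *+ (s.+2 * l)]mulr_natl natrM -!mulrA ler_wpM2l//.
by rewrite ler_pdivlMl// mulrA.
Qed.

(** * Logarithmic increments and the hypotheses in usable form *)

(** Treats [log p] and [log c] together: [phi] is [mass] for the former and [diam d \o E] for the
    latter. *)
Definition log_ratio (phi : seq I -> R) (u : seq I) : R :=
  ln (phi u / phi (take (size u).-1 u)).

Lemma log_ratio_rcons phi w a : log_ratio phi (rcons w a) = ln (phi (rcons w a) / phi w).
Proof. by rewrite /log_ratio size_rcons/= -cats1 take_size_cat. Qed.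

Lemma pwE w a : pw E mu w a = mass (rcons w a) / mass w.
Proof.
rewrite /pw -/(mass w) -/(mass (rcons w a)).
by case: eqP => // ->; rewrite invr0 mulr0.
Qed.

Lemma pw_ge0 w a : 0 <= pw E mu w a.
Proof. by rewrite pwE divr_ge0 ?mass_ge0. Qed.

Lemma second_momentE w : second_moment d Sigma E mu w =
  \sum_(a <- kids w) pw E mu w a * (ln (pw E mu w a) ^+ 2 + ln (cw d E w a) ^+ 2).
Proof. exact: sum_children. Qed.

Lemma second_moment_ge0 w : 0 <= second_moment d Sigma E mu w.
Proof.
rewrite second_momentE; apply: sumr_ge0 => a _.
by rewrite mulr_ge0 ?pw_ge0// addr_ge0// sqr_ge0.
Qed.

Lemma msq_mass_le w :
  tree_msq kids mass (log_ratio mass) w <= second_moment d Sigma E mu w.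
Proof.
rewrite second_momentE; apply: ler_sum => a _.
by rewrite log_ratio_rcons -pwE ler_wpM2l ?pw_ge0// lerDl sqr_ge0.
Qed.

Lemma msq_diam_le w :
  tree_msq kids mass (log_ratio (diam d \o E)) w <= second_moment d Sigma E mu w.
Proof.
rewrite second_momentE; apply: ler_sum => a _.
by rewrite log_ratio_rcons -pwE ler_wpM2l ?pw_ge0// lerDr sqr_ge0.
Qed.

Lemma entropy_sumE i N : entropy_sum Sigma E mu i N =
  \sum_(1 <= k < N.+1) tree_mean kids mass (log_ratio mass) (restr i k).
Proof.
apply: eq_bigr => k _; rewrite sum_children; apply: eq_bigr => a _.
by rewrite log_ratio_rcons pwE.
Qed.

Lemma lyapunov_sumE i N : lyapunov_sum d Sigma E mu i N =
  \sum_(1 <= k < N.+1) tree_mean kids mass (log_ratio (diam d \o E)) (restr i k).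
Proof.
apply: eq_bigr => k _; rewrite sum_children; apply: eq_bigr => a _.
by rewrite log_ratio_rcons pwE.
Qed.

Lemma take_restr (i : nat -> I) k n : (k <= n)%N -> take k (restr i n) = restr i k.
Proof. by move=> kn; rewrite /restr /mkseq -map_take take_iota (minn_idPl kn). Qed.

Lemma tree_dev_restr phi i N : (forall n, 0 < phi (restr i n)) ->
  tree_dev kids mass (log_ratio phi) (restr i N.+1) =
  ln (phi (restr i N.+1)) - ln (phi (restr i 1)) -
  \sum_(1 <= k < N.+1) tree_mean kids mass (log_ratio phi) (restr i k).
Proof.
move=> phi0; rewrite /tree_dev size_mkseq.
rewrite -(@telescope_sumr _ 1 N.+1 (fun k => ln (phi (restr i k))))// -sumrB.
apply: eq_big_nat => k /andP[_ kN].
rewrite !take_restr// 1?ltnW// /log_ratio size_mkseq/= take_restr//.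
by rewrite ln_div// posrE.
Qed.

(** The increments telescope from generation 1. Half of [l] bounds the deviation, the other half
    absorbs the fixed term [ln (phi (restr i 1))]. *)
Lemma log_ratio_average phi i : (forall n, 0 < phi (restr i n)) ->
  (forall l, 0 < l -> exists K, forall n, (K <= n)%N ->
     ~~ dev_hit kids mass (log_ratio phi) l (restr i n)) ->
  forall l, 0 < l -> exists n0, forall n, (n0 <= n)%N ->
    `|ln (phi (restr i n.+1))
      - \sum_(1 <= k < n.+1) tree_mean kids mass (log_ratio phi) (restr i k)|
    <= l * n.+1%:R.
Proof.
move=> phi0 hit l l0; have [|K hK] := hit (l / 2); first by rewrite divr_gt0.
pose b := `|ln (phi (restr i 1))|.
exists (maxn K (Num.truncn (b / (l / 2)))) => n; rewrite geq_max => /andP[Kn bn].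
have := hK n.+1 (leqW Kn).
rewrite /dev_hit -leNgt size_mkseq (tree_dev_restr _ phi0).
set s := \sum_(_ <= _ < _) _; set u := ln _; set w := ln _ => h.
have bl : b <= l / 2 * n.+1%:R.
  rewrite mulrC -ler_pdivrMr ?divr_gt0//; apply: (le_trans (ltW (truncnS_gt _))).
  by rewrite ler_nat ltnS.
have -> : u - s = (u - w - s) + w by ring.
apply: (le_trans (ler_normD _ _)); rewrite -/w -/b in bl *; rewrite -/b.
by rewrite [l * _](_ : _ = l / 2 * n.+1%:R + l / 2 * n.+1%:R) ?lerD//; field.
Qed.

Lemma level_nonempty n : exists w, Sigma_n Sigma n w.
Proof.
elim: n => [|n [w [Sw sw]]]; first by exists [::]; split => //; exact: Sigma_nil.
case: tree => _ _ /(_ _ Sw) [_ [a Sa]].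
by exists (rcons w a); split => //; rewrite size_rcons sw.
Qed.

(** Summability forces each supremum with [n >= 1] to be finite, and nonempty generations make it
    nonnegative; its real value serves as [v n]. *)
Lemma moment_bounds :
  (\sum_(1 <= n <oo)
     ((n%:R ^- 2)%:E *
      ereal_sup [set (second_moment d Sigma E mu w)%:E | w in Sigma_n Sigma n])
   < +oo)%E ->
  exists v C, [/\ forall k, 0 <= v k,
    forall n w, (0 < n)%N -> w \in level kids n -> second_moment d Sigma E mu w <= v n &
    forall N, \sum_(1 <= k < N) v k / k%:R ^+ 2 <= C].
Proof.
pose sp n := ereal_sup [set (second_moment d Sigma E mu w)%:E | w in Sigma_n Sigma n].
rewrite -/sp => fin.
have sp_ub n w : w \in level kids n -> ((second_moment d Sigma E mu w)%:E <= sp n)%E.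
  by move=> /mem_level wl; apply: ereal_sup_ubound; exists w.
have sp0 n : (0 <= sp n)%E.
  have [w wn] := level_nonempty n.
  apply: le_trans (sp_ub n w _); last exact/mem_level.
  by rewrite lee_fin second_moment_ge0.
have t0 n : (0 <= (n%:R ^- 2)%:E * sp n)%E.
  by rewrite mule_ge0// lee_fin invr_ge0 exprn_ge0.
have part N : (\sum_(1 <= n < N) (n%:R ^- 2)%:E * sp n <=
    \sum_(1 <= n <oo) (n%:R ^- 2)%:E * sp n)%E.
  by apply: nneseries_lim_ge => n _ _.
have spf n : (0 < n)%N -> sp n = (fine (sp n))%:E.
  move=> n0; rewrite fineK// ge0_fin_numE//.
  rewrite ltNge leye_eq; apply/negP => /eqP spy.
  have := le_lt_trans (part n.+1) fin.
  rewrite big_nat_recr//= spy gt0_muley ?lte_fin ?invr_gt0 ?exprn_gt0 ?ltr0n//.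
  by rewrite addey// gt_eqF// (lt_le_trans (ltNyr 0))// sume_ge0.
exists (fine \o sp), (fine (\sum_(1 <= n <oo) (n%:R ^- 2)%:E * sp n)%E); split.
- by move=> k; rewrite /= fine_ge0.
- by move=> n w n0 wl; rewrite -lee_fin /= -spf// sp_ub.
- move=> N; rewrite -lee_fin fineK; last first.
    by rewrite ge0_fin_numE// nneseries_ge0.
  apply: le_trans (part N); rewrite -sumEFin big_nat_cond [leRHS]big_nat_cond.
  apply: lee_sum => n /andP[/andP[n0 _] _].
  by rewrite [in leRHS]spf// -EFinM mulrC.
Qed.

Lemma mindiam_growth i :
  Sigma_inf Sigma i ->
  (forall e : R, 0 < e -> exists n0, forall i, Sigma_inf Sigma i ->
     forall n, (n0 <= n)%N ->
     `| ln (diam d (E (restr i n))) / ln (mindiam d Sigma E (restr i n)) - 1 | < e) ->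
  forall e, 0 < e < 1 -> exists n0, forall n, (n0 <= n)%N ->
    ln (diam d (E (restr i n))) <= (1 - e) * ln (diam d (E (restr i n.+1))).
Proof.
move=> Si M5 e /andP[e0 e1]; have [n0 hn0] := M5 e e0.
have /cvgrPdist_lt/(_ _ ltr01) [n1 _ hn1] := E_shrink Si.
exists (maxn n0 n1) => n; rewrite geq_max => /andP[/(hn0 _ Si) + /hn1 /=].
set D := diam d _; set m := mindiam _ _ _ _; set D' := diam _ _.
have D0 : 0 < D by apply: E_diam; exact: Si.
have D'0 : 0 < D' by apply: E_diam; exact: Si.
rewrite sub0r normrN [`|D|]gtr0_norm// => h D1.
have Sn : Sigma (rcons (restr i n) (i n)) by have := Si n.+1; rewrite /restr restrS.
have mD' : m <= D'.
  apply: ge_inf; last by exists (i n) => //; rewrite /D' /restr restrS.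
  by exists 0 => _ [a Sa <-]; rewrite ltW// E_diam.
have D'D : D' <= D by rewrite /D -(take_restr i (leqnSn n)); exact: diam_take (Si _).
(* For [m <= 0] the convention [ln m = 0] makes the quotient in (M5) zero, at distance 1 from its
   limit, against [e < 1]. *)
have [m0|m0] := leP m 0.
  by move: h; rewrite (ln0 m0) invr0 mulr0 sub0r normrN normr1; lra.
have lm : ln m < 0 by rewrite ln_lt0// m0 (le_lt_trans mD')// (le_lt_trans D'D).
have lD' : ln m <= ln D' by rewrite ler_ln ?posrE.
have : 1 - e < ln D / ln m by move: h; rewrite ltr_norml; lra.
rewrite ltr_ndivlMr// => hD; apply: (le_trans (ltW hD)).
by rewrite ler_pM2l// subr_gt0.
Qed.

Lemma liminf_rate i :
  (0 < limn_einf (fun n => ((- ln (diam d (E (restr i n)))) / n%:R)%:E))%E ->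
  exists2 c : R, 0 < c & exists n0, forall n, (n0 <= n)%N ->
    c * n%:R <= - ln (diam d (E (restr i n))).
Proof.
rewrite /limn_einf -/(limf_einf _ \oo) limf_einfE.
move=> /ereal_sup_gt [_ [V /nbhs_ooP [N hN] <-]].
set J := ereal_inf _ => J0.
have lb n : (N <= n)%N -> (J <= ((- ln (diam d (E (restr i n)))) / n%:R)%:E)%E.
  by move=> /hN Vn; apply: ereal_inf_lbound; exists n.
have [c c0 cJ] : exists2 c : R, 0 < c & (c%:E <= J)%E.
  case: J J0 {lb} => [c| |]//; first by rewrite lte_fin => c0; exists c.
  by move=> _; exists 1; rewrite ?leey.
exists c => //; exists (maxn N 1) => n; rewrite geq_max => /andP[/lb Jn n0].
have := le_trans cJ Jn; rewrite lee_fin ler_pdivlMr// ltr0n//.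
Qed.

End MoranTree.

(** * Exceptional null sets and the conclusion *)

Theorem theorem4p3 (R : realType) (X : Type) (d : X -> X -> R)
  (I : countType) (Sigma : set (seq I)) (E : seq I -> set X)
  (mu : {outer_measure set X -> \bar R}) :
  is_metric d -> complete_d d -> doubling_d d ->
  is_Moran d Sigma E ->
  is_measure_d d mu ->
  mu (~` limit_set Sigma E) = 0%E ->
  (forall i, Sigma_inf Sigma i ->
     (0 < limn_einf (fun n => ((- ln (diam d (E (restr i n)))) / n%:R)%:E))%E) ->
  (\sum_(1 <= n <oo)
     ((n%:R ^- 2)%:E *
      ereal_sup [set (second_moment d Sigma E mu w)%:E | w in Sigma_n Sigma n])
   < +oo)%E ->
  mu (~` [set x | exists i, [/\ Sigma_inf Sigma i,
            (forall n, E (restr i n) x),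
            ldim_up d mu x = limn_esup (fun N => (dim_ratio d Sigma E mu i N)%:E) &
            ldim_low d mu x = limn_einf (fun N => (dim_ratio d Sigma E mu i N)%:E)]])
  = 0%E.
Proof.
move=> dm _ [N dbl] [tree [cd [nest [shrink [disj [[C0 C00 Eball] M5]]]]]].
move=> mum full rate summ.
have Ec w (Sw : Sigma w) := proj1 (cd w Sw).
have Ed w (Sw : Sigma w) := proj2 (cd w Sw).
have [v [C [v0 vmom vsum]]] := moment_bounds tree summ.
have msqp n w : (0 < n)%N -> w \in level (kids Sigma) n ->
    tree_msq (kids Sigma) (mass E mu) (log_ratio (mass E mu)) w <= v n.
  by move=> n0 wl; apply: le_trans (vmom n w n0 wl); exact: msq_mass_le.
have msqc n w : (0 < n)%N -> w \in level (kids Sigma) n ->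
    tree_msq (kids Sigma) (mass E mu) (log_ratio (diam d \o E)) w <= v n.
  by move=> n0 wl; apply: le_trans (vmom n w n0 wl); exact: msq_diam_le.
have nullp := strong_law_null dm tree Ec Ed nest disj mum full v0 msqp vsum.
have nullc := strong_law_null dm tree Ec Ed nest disj mum full v0 msqc vsum.
have nullm := null_mass_paths dm tree Ec Ed nest disj mum full.
have [s Ns] : exists s, (N <= 2 ^ s)%N by exists N; rewrite ltnW// ltn_expl.
have [t0 t0C] : exists t0, C0^-1 <= 2 ^+ t0.
  exists (Num.truncn C0^-1); apply: (le_trans (ltW (truncnS_gt _))).
  by rewrite -natrX ler_nat ltn_expl.
have nullh := heavy_null dm tree Ec Ed nest shrink disj mum full dbl C00 Eball Ns t0C.
(* The discarded points lie off the limit set, in a cylinder of mass zero, in heavy cylinders at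
   infinitely many scales, or on paths with infinitely many deviation hits for [log p] or for
   [log c]. *)
have := outer_nullU (outer_nullU full nullm) (outer_nullU nullh (outer_nullU nullp nullc)).
apply: outer_null_sub => x nx; apply: contrapT; move=> /not_orP [/not_orP [Lx mx]].
move=> /not_orP [hx /not_orP [px cx]]; apply: nx.
have {Lx}Lx : limit_set Sigma E x by apply: contrapT.
have [i Si ix] := limit_path tree nest disj Lx.
have mpos n : 0 < mass E mu (restr i n).
  rewrite lt_neqAle mass_ge0 andbT eq_sym; apply/eqP => m0; apply: mx.
  by exists n, (restr i n); split => //; exact: Sigma_inf_level.
have dpos n : 0 < (diam d \o E) (restr i n) by exact: Ed (Si n).
have nohit Z : ~ (exists i lam, [/\ Sigma_inf Sigma i, forall n, E (restr i n) x,
    0 < lam & forall K, exists2 n, (K <= n)%N &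
      dev_hit (kids Sigma) (mass E mu) Z lam (restr i n)]) ->
    forall l, 0 < l -> exists K, forall n, (K <= n)%N ->
     ~~ dev_hit (kids Sigma) (mass E mu) Z l (restr i n).
  move=> nz l l0; apply: contrapT => nK; apply: nz; exists i, l; split => // K.
  apply: contrapT => nh; apply: nK; exists K => n Kn; apply/negP => hit.
  by apply: nh; exists n.
have avp := log_ratio_average mpos (nohit _ px).
have avc := log_ratio_average dpos (nohit _ cx).
have [c c0 hc] := liminf_rate (rate i Si).
have bm := ball_massE dm tree Ec Ed nest disj mum full.
pose D n := diam d (E (restr i n)); pose m n := mass E mu (restr i n).
have Ddec n k : (n <= k)%N -> D k <= D n.
  move=> nk; rewrite /D -(take_restr i nk).
  exact: (diam_take dm tree Ec Ed nest _ (Si k)).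
have mball n r : D n <= r -> m n <= ball_mass d mu x r.
  move=> Dr; apply: le_trans (ball_mass_le dm tree Ec Ed nest disj mum full x Dr).
  exact: (mass_le_ball dm tree Ec Ed nest disj mum full (Si n) (ix n)).
have FE r : 0 < r -> 0 < ball_mass d mu x r ->
    (lne (mu (cball d x r)) * ((ln r)^-1)%:E)%E = (ln (ball_mass d mu x r) / ln r)%:E.
  by move=> r0 b0; rewrite bm lne_EFin.
have [up1 low1] := ball_symbolic_limits (ler0n _ s.+2) dpos Ddec (shrink i Si)
  mpos mball FE
  (ball_mass_upper dm tree Ec Ed nest shrink disj mum full c0 hc Si ix mpos hx)
  (mindiam_growth dm tree Ec Ed nest shrink Si M5).
have avp' l : 0 < l -> exists n0, forall n, (n0 <= n)%N ->
    `|ln (m n.+1) - entropy_sum Sigma E mu i n| <= l * n.+1%:R.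
  move=> /avp [K hK]; exists K => n Kn.
  by rewrite entropy_sumE//; exact: hK.
have avc' l : 0 < l -> exists n0, forall n, (n0 <= n)%N ->
    `|ln (D n.+1) - lyapunov_sum d Sigma E mu i n| <= l * n.+1%:R.
  move=> /avc [K hK]; exists K => n Kn.
  by rewrite lyapunov_sumE//; exact: hK.
have [up2 low2] := symbolic_average_limits c0 hc avp' avc'.
exists i; split => //; first by rewrite /ldim_up up1 up2.
by rewrite /ldim_low low1 low2.
Qed.
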